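(* Let $(M,g)$ be a compact $n$-dimensional Riemannian manifold with smooth boundary $\partial M$ and let $h$ be a smooth function on $M$. Assume that there are constants $A>0$ and $z>0$ such that $$\mathrm{Ric}+D^2h\geq \left(\frac{|Dh|^2}{nz}+A\right)g$$ on $M$. (1) If the modified mean curvature $H-h_{\nu}$ of $\partial M$ is non-negative, then the first Dirichlet eigenvalue $\lambda_D$ of the drifting Laplacian $L_h$ satisfies $$\lambda_D \geq \frac{n(z+1)A}{n(z+1)-1}.$$ (2) If $\partial M$ is convex, that is, its second fundamental form is non-negative, then the first (nonzero) Neumann eigenvalue $\lambda_N$ of $L_h$ satisfies $$\lambda_N \geq \frac{n(z+1)A}{n(z+1)-1}.$$
   Context: The drifting Laplacian (h-Laplacian) is $L_h u=\Delta u-\langle\nabla h,\nabla u\rangle$, where $\Delta$ is the Laplace-Beltrami operator (trace of the Hessian), associated with the weighted measure $dm=e^{-h}dv$, $dv$ being the Riemannian volume measure. $D^2h$ is the Hessian of $h$ and $|Dh|$ is the norm of its gradient. Eigenvalues $\lambda$ are those of $-L_hu=\lambda u$ with $u$ not identically zero (normalized by $\int_M u^2dm=1$, so $\lambda=\int_M|\nabla u|^2dm$), under the Dirichlet condition $u=0$ on $\partial M$ (first eigenvalue $\lambda_D$) or the Neumann condition $\partial u/\partial\nu=0$ on $\partial M$ (first nonzero eigenvalue $\lambda_N$). $\nu$ is the unit outward normal to $\partial M$, $h_\nu=\langle\nabla h,\nu\rangle$, the second fundamental form of $\partial M$ is the bilinear form $(X,Y)\mapsto g(\nabla_X\nu,Y)$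 on tangent vectors to $\partial M$, and the mean curvature $H$ is its trace. An inequality between symmetric 2-tensors means that the difference is positive semidefinite. *)

(* Defs.v *)
(* Riemannian geometry in local coordinates, on a manifold with boundary of
   dimension n.+1 modelled on the half-space { x | 0 <= x_0 }.  Coordinates are
   numbered from 0; coordinate 0 is the inward one at boundary points, and
   e_1, ..., e_n span the tangent space of the boundary. *)
From HB Require Import structures.
From mathcomp Require Import all_boot all_order all_algebra.
From mathcomp Require Import all_classical all_reals all_analysis.
Set Implicit Arguments.
Unset Strict Implicit.
Unset Printing Implicit Defensive.
Import Order.TTheory GRing.Theory Num.Theory.
Import numFieldNormedType.Exports.
Local Open Scope classical_set_scope.
Local Open Scope ring_scope.

Section HalfSpace.
Variables (R : realType) (n : nat).

Definition basis_vec (i : 'I_n.+1) : 'rV[R]_n.+1 := delta_mx 0 i.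

Definition half_space : set 'rV[R]_n.+1 := [set x | 0 <= x 0 ord0].

Definition iter_partial (s : seq 'I_n.+1) (f : 'rV[R]_n.+1 -> R) :
    'rV[R]_n.+1 -> R :=
  foldr (fun i F x => 'D_(basis_vec i) F x) f s.

(* C^oo on O, for O open. *)
Definition smooth_open (O : set 'rV[R]_n.+1) (f : 'rV[R]_n.+1 -> R) : Prop :=
  forall (s : seq 'I_n.+1) (x : 'rV[R]_n.+1),
    O x -> differentiable (iter_partial s f) x.

(* C^oo on a set S that need not be open: local extendability. *)
Definition smooth_on (S : set 'rV[R]_n.+1) (f : 'rV[R]_n.+1 -> R) : Prop :=
  forall x, S x -> exists (O : set 'rV[R]_n.+1) (F : 'rV[R]_n.+1 -> R),
    [/\ open O, O x, smooth_open O F & forall y, O y -> S y -> F y = f y].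

End HalfSpace.

(* cmap : cdom -> cmap @` cdom is a homeomorphism from an open set of M onto a
   relatively open set of the half-space, with inverse cinv.  The values of
   cmap and cinv outside these sets are irrelevant. *)
Record half_chart (R : realType) (n : nat) (M : topologicalType) := HalfChart {
  cdom : set M;
  cmap : M -> 'rV[R]_n.+1;
  cinv : 'rV[R]_n.+1 -> M;
  cdom_open : open cdom;
  cimg_open : exists2 O : set 'rV[R]_n.+1,
    open O & cmap @` cdom = O `&` @half_space R n;
  cmapK : forall p, cdom p -> cinv (cmap p) = p;
  cmap_continuous : {within cdom, continuous cmap};
  cinv_continuous : {within cmap @` cdom, continuous cinv} }.

(* Smooth manifolds with (possibly empty) boundary, of dimension n.+1, given by
   an arbitrary smooth atlas. *)
Record bmanifold (R : realType) (n : nat) := BManifold {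
  carrier :> topologicalType;
  carrier_hausdorff : hausdorff_space carrier;
  carrier_second_countable : @second_countable carrier;
  charts : Type;
  chart_of : charts -> half_chart R n carrier;
  charts_cover : forall p : carrier, exists c, cdom (chart_of c) p;
  charts_compatible : forall (c c' : charts) (i : 'I_n.+1),
    smooth_on
      (cmap (chart_of c) @` (cdom (chart_of c) `&` cdom (chart_of c')))
      (fun x => cmap (chart_of c') (cinv (chart_of c) x) 0 i) }.

Arguments charts {R n} M : rename.
Arguments chart_of {R n M} c : rename.
Coercion chart_of : charts >-> half_chart.

Section Calculus.
Variables (R : realType) (n : nat) (M : bmanifold R n).
Implicit Types (c : charts M) (f : M -> R) (p : M).

Definition smooth f : Prop :=
  forall c, smooth_on (cmap c @` cdom c) (f \o cinv c).

Definition boundary_pt c p : Prop := cdom c p /\ cmap c p 0 ord0 = 0.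

Definition boundary : set M := [set p | exists c, boundary_pt c p].

(* The i-th coordinate derivative of f in the chart c at p.  The forward
   difference quotient never leaves the half-space (t > 0), so that this is the
   i-th partial derivative of any smooth local extension of f \o cinv c to
   R^n.+1, at boundary points as well as at interior ones. *)
Definition partial c (i : 'I_n.+1) f p : R :=
  lim (t^-1 * (f (cinv c (cmap c p + t *: basis_vec R i)) - f p)
        @[t --> (0 : R)^'+]).

Definition jacobian c c' p : 'M[R]_n.+1 :=
  \matrix_(i, j) partial c j (fun q => cmap c' q 0 i) p.

End Calculus.

Arguments boundary {R n} M.

(* gmat c p is the matrix (g_ij) of the metric at p in the chart c. *)
Record riem_metric (R : realType) (n : nat) (M : bmanifold R n) := RiemMetric {
  gmat :> charts M -> M -> 'M[R]_n.+1;
  gmat_sym : forall (c : charts M) (p : M), cdom c p -> (gmat c p)^T = gmat c p;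
  gmat_pos : forall (c : charts M) (p : M) (v : 'rV[R]_n.+1), cdom c p -> v != 0 ->
    0 < (v *m gmat c p *m v^T) 0 0;
  gmat_change : forall (c c' : charts M) (p : M), cdom c p -> cdom c' p ->
    gmat c p = (jacobian c c' p)^T *m gmat c' p *m jacobian c c' p;
  gmat_smooth : forall (c : charts M) i j,
    smooth_on (cmap c @` cdom c) (fun x => gmat c (cinv c x) i j) }.

Section Riemannian.
Variables (R : realType) (n : nat) (M : bmanifold R n) (g : riem_metric M).
Implicit Types (c : charts M) (f h u : M -> R) (p : M) (X Y : 'rV[R]_n.+1).

(* V c p is the row of components at p, in the chart c, of a vector field. *)
Implicit Types (V nu : charts M -> M -> 'rV[R]_n.+1).

Definition inner c p X Y : R := (X *m g c p *m Y^T) 0 0.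

Definition ginv c p : 'M[R]_n.+1 := invmx (g c p).

(* Gamma^k_ij of the Levi-Civita connection. *)
Definition christoffel c (k i j : 'I_n.+1) p : R :=
  2^-1 * \sum_l ginv c p k l *
    (partial c i (fun q => g c q j l) p + partial c j (fun q => g c q i l) p
     - partial c l (fun q => g c q i j) p).

(* The component dx^l (Rm (e_i, e_j) e_k) of
   Rm (X, Y) Z = nabla_X nabla_Y Z - nabla_Y nabla_X Z - nabla_[X, Y] Z. *)
Definition riemann c (l k i j : 'I_n.+1) p : R :=
  partial c i (christoffel c l j k) p - partial c j (christoffel c l i k) p
  + \sum_m (christoffel c l i m p * christoffel c m j k p
            - christoffel c l j m p * christoffel c m i k p).

Definition ricci c p : 'M[R]_n.+1 :=
  \matrix_(j, k) \sum_i riemann c i k i j p.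

Definition gradient f c p : 'rV[R]_n.+1 :=
  \row_i \sum_j ginv c p i j * partial c j f p.

Definition hessian f c p : 'M[R]_n.+1 :=
  \matrix_(i, j) (partial c i (partial c j f) p
                  - \sum_k christoffel c k i j p * partial c k f p).

(* The trace with respect to g of a symmetric 2-tensor. *)
Definition laplacian f c p : R := \tr (ginv c p *m hessian f c p).

Definition drift_laplacian h u c p : R :=
  laplacian u c p - inner c p (gradient h c p) (gradient u c p).

(* nabla_X V *)
Definition covariant V c p X : 'rV[R]_n.+1 :=
  \row_k \sum_i X 0 i *
    (partial c i (fun q => V c q 0 k) p
     + \sum_j christoffel c k i j p * V c p 0 j).

Definition boundary_tangent X : Prop := X 0 ord0 = 0.

(* Only the values of nu at boundary points matter. *)
Definition outward_unit_normal nu : Prop :=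
  forall c p, boundary_pt c p ->
    [/\ inner c p (nu c p) (nu c p) = 1,
        forall X, boundary_tangent X -> inner c p (nu c p) X = 0
      & nu c p 0 ord0 < 0].

(* To be used for X and Y tangent to the boundary: then covariant nu c p X only
   involves derivatives of nu along the boundary. *)
Definition second_form nu c p X Y : R := inner c p (covariant nu c p X) Y.

Definition boundary_basis (a : 'I_n) : 'rV[R]_n.+1 :=
  basis_vec R (lift ord0 a).

(* The trace (not the average) of the second fundamental form with respect to
   the metric induced on the boundary. *)
Definition mean_curvature nu c p : R :=
  \tr (invmx (\matrix_(a < n, b < n)
                inner c p (boundary_basis a) (boundary_basis b))
       *m \matrix_(a < n, b < n)
            second_form nu c p (boundary_basis a) (boundary_basis b)).

Definition normal_deriv nu f c p : R := inner c p (gradient f c p) (nu c p).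

Definition convex_boundary nu : Prop :=
  forall c p X, boundary_pt c p -> boundary_tangent X ->
    0 <= second_form nu c p X X.

Definition eigenfunction h (lambda : R) u : Prop :=
  [/\ smooth u, exists p, u p <> 0
    & forall c p, cdom c p -> - drift_laplacian h u c p = lambda * u p].

Definition dirichlet_eigenvalue h (lambda : R) : Prop :=
  exists2 u, eigenfunction h lambda u & forall p, boundary M p -> u p = 0.

Definition neumann_eigenvalue nu h (lambda : R) : Prop :=
  exists2 u, eigenfunction h lambda u
    & forall c p, boundary_pt c p -> normal_deriv nu u c p = 0.

Definition first_dirichlet_eigenvalue h (lambda : R) : Prop :=
  dirichlet_eigenvalue h lambda /\
  forall mu, dirichlet_eigenvalue h mu -> lambda <= mu.

Definition first_neumann_eigenvalue nu h (lambda : R) : Prop :=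
  [/\ neumann_eigenvalue nu h lambda, lambda != 0
    & forall mu, neumann_eigenvalue nu h mu -> mu != 0 -> lambda <= mu].

End Riemannian.

Definition psd (R : realType) (n : nat) (T : 'M[R]_n) : Prop :=
  forall v : 'rV[R]_n, 0 <= (v *m T *m v^T) 0 0.

(* Main.v *)
(* No integration is needed: the estimates follow from the maximum principle.
   Let L u = - lambda u, let N = n (z + 1) for the dimension n, and consider
     F = |Du|^2 / 2 + (b / 2) u^2.
   The Bochner formula, the trace inequality |D^2 u|^2 >= (Delta u)^2 / n with
   Delta u = - lambda u + <Dh, Du>, and the elementary inequality
   (x + y)^2 >= x^2 / (z + 1) - y^2 / z, in which the term in <Dh, Du>^2 is
   absorbed by the curvature hypothesis, give
     L F >= (lambda^2 / N - b lambda) u^2 + (A - lambda + b) |Du|^2.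
   If lambda <> 0 were smaller than N A / (N - 1), some b > 0 would make both
   coefficients positive.  At a maximum of F on the boundary, the outward normal
   derivative of F is - II (Du, Du) in the Neumann case and
   - (H - h_nu) u_nu^2 in the Dirichlet case, hence nonpositive; so D F vanishes
   at the maximum, L F <= 0 there, u and D u vanish there, F <= 0, and u = 0.
   For lambda = 0 in the Dirichlet case, b = 0 yields D u = 0, so u is constant
   on every component, hence zero because the component meets the boundary. *)
Require Import Defs.
From HB Require Import structures.
From mathcomp Require Import all_boot all_order all_algebra.
From mathcomp Require Import all_classical all_reals all_analysis.
From mathcomp Require Import ring lra.
Set Implicit Arguments.
Unset Strict Implicit.
Unset Printing Implicit Defensive.
Import Order.TTheory GRing.Theory Num.Theory.
Import numFieldNormedType.Exports.
Local Open Scope classical_set_scope.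
Local Open Scope ring_scope.

(** * Calculus on open sets *)

(** The boundary shapes the proof: a maximum of F may lie on it, where only inward rays are
    available and partial derivatives are one-sided limits. Functions are therefore handled through
    local extensions across the boundary. At a boundary maximum the outward derivative of F is
    nonnegative because the inward one is nonpositive; as the curvature condition gives the opposite
    sign, the point is critical. A quadratic form takes the same value at v and -v, so inward rays
    then suffice for the whole second-derivative test, and boundary maxima are treated like interior
    ones. The term in u^2 trades |Du|^2 against u^2: L (u^2 / 2) = |Du|^2 - lambda u^2, so b raises
    the coefficient of |Du|^2, which is A - lambda without it, and, for lambda > 0, lowers that of
    u^2. It costs nothing on the boundary, where its normal derivative b u u_nu vanishes under
    either boundary condition. *)

Section DirectionalDerivatives.
Variables (R : realType) (V : normedModType R).
Implicit Types (F : V -> R) (x v w : V).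

Lemma diff_expansion F x : differentiable F x ->
  forall e : R, 0 < e ->
  \forall y \near (0 : V), `|F (x + y) - F x - 'd F x y| <= e * `|y|.
Proof.
move=> dF e e0.
have /eqaddoP/(_ _ e0) := diff_locally dF; apply: filterS => y.
by rewrite !fctE /= opprD addrA (addrC y).
Qed.

Lemma is_derive_line F x v (t : R) : differentiable F (x + t *: v) ->
  is_derive t (1 : R) (fun s : R => F (x + s *: v)) ('D_v F (x + t *: v)).
Proof.
move=> dF.
have dl : is_diff t (fun s : R => x + s *: v) (fun s => s *: v).
  have := is_diffD (is_diff_cst x t) (is_diff_scalel t v).
  by move=> h; apply: (is_diff_eq h); rewrite funeqE => s /=; rewrite !fctE add0r.
have dFt : is_diff (x + t *: v) F ('d F (x + t *: v)) by exact/differentiableP.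
have dc : is_diff t (F \o (fun s : R => x + s *: v))
            ('d F (x + t *: v) \o (fun s => s *: v)).
  exact: is_diff_comp.
have dd : differentiable (F \o (fun s : R => x + s *: v)) t by [].
apply: DeriveDef; first exact: diff_derivable.
rewrite (deriveE v dF); apply: etrans (deriveE _ dd) _.
by rewrite diff_val /= scale1r.
Qed.

Lemma mvt_line F x v (t : R) : 0 < t ->
  (forall s, 0 <= s <= t -> differentiable F (x + s *: v)) ->
  exists2 s, 0 < s < t & F (x + t *: v) - F x = t * 'D_v F (x + s *: v).
Proof.
move=> t0 dF.
have [s | | s] := @MVT R (fun s => F (x + s *: v))
    (fun s => 'D_v F (x + s *: v)) 0 t t0.
- by rewrite in_itv /= => /andP[s0 st]; apply: is_derive_line; apply: dF; rewrite !ltW.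
- apply: derivable_within_continuous => s; rewrite in_itv /= => st.
  by have [] := is_derive_line (dF s st).
- by rewrite in_itv /= subr0 scale0r addr0 mulrC; exists s.
Qed.

Lemma near_line x v (P : V -> Prop) : (\forall y \near x, P y) ->
  exists2 r : R, 0 < r & forall s : R, `|s| <= r -> P (x + s *: v).
Proof.
move=> Px.
have cl : (fun s : R => x + s *: v) @ (0 : R) --> x.
  have -> : x = x + 0 *: v by rewrite scale0r addr0.
  rewrite [X in X @ _ --> _](_ : _ = (fun s : R => x + s *: v)); last first.
    by apply/funext => s; rewrite scale0r addr0.
  apply: cvgD; first exact: cvg_cst.
  by apply: cvgZr_tmp; exact: cvg_id.
have /nbhs_ballP[r /= r0 Pr] := cl _ Px.
exists (r / 2); first by rewrite divr_gt0.
move=> s sr; apply: Pr; rewrite /ball /= sub0r normrN (le_lt_trans sr)//.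
by rewrite ltr_pdivrMr// ltr_pMr// ltr1n.
Qed.

Lemma near_plane x v w (P : V -> Prop) : (\forall y \near x, P y) ->
  exists2 r : R, 0 < r & forall s t : R, `|s| <= r -> `|t| <= r ->
    P (x + s *: v + t *: w).
Proof.
move=> /nbhs_ballP[e /= e0 Pe].
pose K := `|v| + `|w| + 1.
have K0 : 0 < K by rewrite ltr_wpDl// addr_ge0.
exists (e / 2 / K); first by rewrite !divr_gt0.
move=> s t sr tr; apply: Pe; rewrite -ball_normE /ball_ /=.
rewrite !opprD !addrA subrr add0r -opprD normrN (le_lt_trans (ler_normD _ _))//.
rewrite !normrZ (@le_lt_trans _ _ (e / 2 / K * K))//; last first.
  by rewrite divfK ?gt_eqF// ltr_pdivrMr// ltr_pMr// ltr1n.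
rewrite /K !mulrDr mulr1 -[leLHS]addr0 !lerD// ?ler_wpM2r//.
by rewrite !divr_ge0 ?ltW.
Qed.

(** The mixed difference is symmetric in v and w, so this expansion compares the two orders of
    differentiation in [derive_comm]. The mean value theorem in the direction v leaves two values of
    ['D_v F], both estimated by its differential at x. *)
Lemma second_difference F x v w : (\forall y \near x, differentiable F y) ->
  differentiable ('D_v F) x -> forall e : R, 0 < e ->
  exists2 r : R, 0 < r & forall t : R, 0 < t <= r ->
    `|F (x + t *: v + t *: w) - F (x + t *: v) - F (x + t *: w) + F x
      - t ^+ 2 * 'D_w ('D_v F) x| <= e * t ^+ 2.
Proof.
move=> dF dD e e0.
have [r1 r10 Hr1] := near_plane v w dF.
(* Chosen so that |s v + t w| + |s v| <= K t for 0 < s < t; the 1 keeps it positive. *)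
pose K := `|v| + `|v| + `|w| + 1.
have K0 : 0 < K by rewrite ltr_wpDl// !addr_ge0.
have [r2 r20 Hr2] : exists2 r : R, 0 < r & forall s t : R, `|s| <= r -> `|t| <= r ->
    `|'D_v F (x + (s *: v + t *: w)) - 'D_v F x - 'd ('D_v F) x (s *: v + t *: w)|
       <= e / K * `|s *: v + t *: w|.
  have := diff_expansion dD (divr_gt0 e0 K0).
  move=> /(near_plane v w)[r r0 Hr]; exists r => // s t sr tr.
  by have := Hr _ _ sr tr; rewrite add0r.
exists (Num.min r1 r2); first by rewrite lt_min r10.
move=> t /andP[t0]; rewrite le_min => /andP[tr1 tr2].
have nt s : 0 <= s <= t -> `|s| <= t by case/andP => s0 st; rewrite ger0_norm.
pose p s := F (x + t *: w + s *: v) - F (x + s *: v).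
have dF1 s : 0 <= s <= t -> differentiable F (x + t *: w + s *: v).
  move=> st; rewrite addrAC; apply: Hr1; last by rewrite ger0_norm ?(ltW t0).
  exact: le_trans (nt _ st) _.
have dF2 s : 0 <= s <= t -> differentiable F (x + s *: v).
  move=> st; rewrite -[_ + _]addr0 -(scale0r w); apply: Hr1.
    exact: le_trans (nt _ st) _.
  by rewrite normr0 ltW.
have dp s : 0 <= s <= t -> is_derive s (1 : R) p
    ('D_v F (x + t *: w + s *: v) - 'D_v F (x + s *: v)).
  by move=> st; apply: is_deriveB; apply: is_derive_line; [exact: dF1|exact: dF2].
have [s | | s] := @MVT R p
  (fun s => 'D_v F (x + t *: w + s *: v) - 'D_v F (x + s *: v)) 0 t t0.
- by rewrite in_itv /= => /andP[s0 st]; apply: dp; rewrite !ltW.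
- apply: derivable_within_continuous => s; rewrite in_itv /= => st.
  by have [] := dp s st.
rewrite in_itv /= subr0 /p !scale0r !addr0 => /andP[s0 st] E.
have st' : 0 <= s <= t by rewrite !ltW.
have H1 : `|'D_v F (x + (s *: v + t *: w)) - 'D_v F x - 'd ('D_v F) x (s *: v + t *: w)|
       <= e / K * `|s *: v + t *: w|.
  by apply: Hr2; [exact: le_trans (nt _ st') tr2|rewrite ger0_norm ?(ltW t0)].
have H2 : `|'D_v F (x + s *: v) - 'D_v F x - 'd ('D_v F) x (s *: v)|
       <= e / K * `|s *: v|.
  have := Hr2 s 0; rewrite scale0r addr0 normr0 => -> //; last exact: ltW.
  exact: le_trans (nt _ st') tr2.
have -> : F (x + t *: v + t *: w) - F (x + t *: v) - F (x + t *: w) + F x =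
    ('D_v F (x + t *: w + s *: v) - 'D_v F (x + s *: v)) * t.
  by rewrite -E -(addrAC _ (t *: w)); ring.
set a := 'D_v F (x + t *: w + s *: v).
have aE : a = 'D_v F (x + (s *: v + t *: w)).
  by rewrite /a -addrA (addrC (t *: w)).
rewrite -aE in H1.
have dE : 'd ('D_v F) x (s *: v + t *: w) = 'd ('D_v F) x (s *: v) + t * 'D_w ('D_v F) x.
  by rewrite (deriveE w dD) linearD; congr (_ + _); exact: linearZ.
have -> : (a - 'D_v F (x + s *: v)) * t - t ^+ 2 * 'D_w ('D_v F) x =
   t * ((a - 'D_v F x - 'd ('D_v F) x (s *: v + t *: w)) -
        ('D_v F (x + s *: v) - 'D_v F x - 'd ('D_v F) x (s *: v))).
  by rewrite dE; ring.
rewrite normrM gtr0_norm// expr2 mulrCA ler_pM2l//.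
apply: (le_trans (ler_normB _ _)).
apply: (le_trans (lerD H1 H2)).
rewrite -mulrDr -mulrA ler_pM2l// mulrC ler_pdivrMr//.
apply: (le_trans (lerD (ler_normD _ _) (lexx _))).
rewrite !normrZ !(gtr0_norm s0) !(gtr0_norm t0) /K.
rewrite -(subr_ge0) (_ : _ - _ = (t - s) * (`|v| + `|v|) + t); last by ring.
by rewrite addr_ge0 ?mulr_ge0 ?subr_ge0 ?addr_ge0// ltW.
Qed.

Lemma derive_comm F x v w : (\forall y \near x, differentiable F y) ->
  differentiable ('D_v F) x -> differentiable ('D_w F) x ->
  'D_w ('D_v F) x = 'D_v ('D_w F) x.
Proof.
move=> dF dv dw; apply/eqP; rewrite -subr_eq0 -normr_eq0 eq_le normr_ge0 andbT.
apply/ler_addgt0Pr => e e0; rewrite add0r.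
have e20 : 0 < e / 2 by rewrite divr_gt0.
have [r1 r10 H1] := second_difference w dF dv e20.
have [r2 r20 H2] := second_difference v dF dw e20.
pose t := Num.min r1 r2.
have t0 : 0 < t by rewrite lt_min r10.
have {}H1 := H1 t; have {}H2 := H2 t.
rewrite t0 ge_min lexx /= in H1; rewrite t0 ge_min lexx orbT /= in H2.
have {}H1 := H1 isT; have {}H2 := H2 isT.
have t20 : 0 < t ^+ 2 by rewrite exprn_gt0.
rewrite -(ler_pM2l t20) -[X in X * `| _ |](gtr0_norm t20) -normrM.
set D1 := 'D_w _ _ in H1 *; set D2 := 'D_v ('D_w _) _ in H2 *.
rewrite (addrAC x) in H2.
set S := F (x + t *: v + t *: w) in H1 H2.
rewrite [X in `|X|](_ : _ = (S - F (x + t *: w) - F (x + t *: v) + F x - t ^+ 2 * D2) -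
  (S - F (x + t *: v) - F (x + t *: w) + F x - t ^+ 2 * D1)); last by ring.
apply: (le_trans (ler_normB _ _)); apply: (le_trans (lerD H2 H1)).
by rewrite -mulrDl -splitr mulrC.
Qed.

(** A one-sided maximum is enough because the first derivative vanishes: were the second derivative
    positive, ['D_v F] would be positive on a short initial piece of the ray and F would increase
    there. *)
Lemma second_derive_max_ray F x v (r : R) : 0 < r ->
  (\forall y \near x, differentiable F y) -> differentiable ('D_v F) x ->
  'D_v F x = 0 -> (forall t, 0 < t < r -> F (x + t *: v) <= F x) ->
  'D_v ('D_v F) x <= 0.
Proof.
move=> r0 dF dD D0 Fmax; rewrite leNgt; apply/negP => c0.
set c := 'D_v ('D_v F) x in c0.
have [r1 r10 H1] := near_line v dF.
(* This gives e |v| < c, so the linear term of the expansion dominates its error. *)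
pose e := c / 2 / (`|v| + 1).
have v0 : 0 < `|v| + 1 by rewrite ltr_wpDl.
have e0 : 0 < e by rewrite !divr_gt0.
have [r2 r20 H2] := near_line v (diff_expansion dD e0).
pose t := Num.min (r / 2) (Num.min r1 r2).
have t0 : 0 < t by rewrite !lt_min r10 r20 divr_gt0.
have tr : t < r.
  by rewrite gt_min ltr_pdivrMr// ltr_pMr// ltr1n.
have tr1 : t <= r1 by rewrite !ge_min lexx orbT.
have tr2 : t <= r2 by rewrite !ge_min lexx !orbT.
have [s /andP[s0 st] E] : exists2 s, 0 < s < t &
    F (x + t *: v) - F x = t * 'D_v F (x + s *: v).
  apply: mvt_line => // s /andP[s0 st]; apply: H1.
  by rewrite ger0_norm// (le_trans st).
have := Fmax t; rewrite t0 tr -subr_le0 E => /(_ isT).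
rewrite pmulr_rle0// leNgt => /negP; apply.
have /(_ _) := H2 s; rewrite ger0_norm ?(ltW s0)// => /(_ (le_trans (ltW st) tr2)).
rewrite add0r D0 subr0 linearZ /= -(deriveE v dD) -/c normrZ (gtr0_norm s0).
move=> /ler_normlP[]; rewrite opprB => H _; move: H; rewrite lerBlDr -lerBlDl.
apply: lt_le_trans; rewrite subr_gt0 mulrCA ltr_pM2l//.
rewrite /e mulrAC ltr_pdivrMr//; have := normr_ge0 v; nra.
Qed.

End DirectionalDerivatives.

Lemma near_eq_differentiable (R : realType) (V : normedModType R) (F G : V -> R)
    (x : V) : (\forall y \near x, F y = G y) ->
  differentiable F x -> differentiable G x.
Proof.
move=> FG dF; have dc := diff_continuous dF.
have Gx : F x = G x := nbhs_singleton FG.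
have H : G \o shift x = cst (G x) + 'd F x +o_ 0 id.
  have FG0 : \forall y \near (0 : V), F (y + x) = G (y + x).
    by move: FG; rewrite (near_shift 0 x); apply: filterS => y /=; rewrite subr0.
  apply/eqaddoP => e e0; have /eqaddoP/(_ _ e0) := diff_locally dF.
  by apply: filterS2 FG0 => y; rewrite !fctE /= Gx => ->.
apply/diff_locallyP; have -> := diff_unique dc H.
by split.
Qed.

(** * Differentiability of finite order *)

Section DiffN.
Variables (R : realType) (n : nat).
Local Notation V := 'rV[R]_n.+1.
Implicit Types (O : set V) (F G : V -> R) (x : V).

(* [diffn k] says that the iterated partial derivatives of order < k are
   differentiable on [O]; thus [diffn 0] is no condition. *)
Fixpoint diffn (k : nat) O F : Prop :=
  if k is k'.+1 then (forall x, O x -> differentiable F x) /\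
    forall i, diffn k' O ('D_(basis_vec R i) F)
  else True.

Lemma diffn_sub k O O' F : O' `<=` O -> diffn k O F -> diffn k O' F.
Proof.
move=> OO'; elim: k F => // k IH F [dF dD]; split; first (move=> x Ox; apply: dF; exact: OO').
by move=> i; apply: IH; exact: dD.
Qed.

Lemma diffn_pred k O F : diffn k.+1 O F -> diffn k O F.
Proof.
elim: k F => // k IH F [dF dD]; split => // i; apply: IH; exact: dD.
Qed.

Lemma diffn_eq k O F G : open O -> (forall x, O x -> F x = G x) ->
  diffn k O F -> diffn k O G.
Proof.
move=> oO; elim: k F G => // k IH F G FG [dF dD].
have FGx x : O x -> \forall y \near x, F y = G y.
  by move=> Ox; have := open_nbhs_nbhs (conj oO Ox); exact: filterS.
split; first by move=> x Ox; apply: near_eq_differentiable (FGx x Ox) (dF _ Ox).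
by move=> i; apply: IH (dD i) => x Ox; apply: near_eq_derive; exact: FGx.
Qed.

Lemma diffn_cst k O (a : R) : open O -> diffn k O (cst a).
Proof.
move=> oO; elim: k a => // k IH a; split => [x _|i]; first exact: differentiable_cst.
by apply: diffn_eq (IH 0) => // x _; rewrite derive_cst.
Qed.

Lemma diffnD k O F G : open O -> diffn k O F -> diffn k O G ->
  diffn k O (fun x => F x + G x).
Proof.
move=> oO; elim: k F G => // k IH F G [dF dDF] [dG dDG]; split => [x Ox|i].
  by apply: differentiableD; [exact: dF|exact: dG].
apply: diffn_eq (IH _ _ (dDF i) (dDG i)) => // x Ox.
by rewrite deriveD//; apply: diff_derivable; [exact: dF|exact: dG].
Qed.

Lemma diffnM k O F G : open O -> diffn k O F -> diffn k O G ->
  diffn k O (fun x => F x * G x).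
Proof.
move=> oO; elim: k F G => // k IH F G kF kG.
have [dF dDF] := kF; have [dG dDG] := kG; split => [x Ox|i].
  by apply: differentiableM; [exact: dF|exact: dG].
have := diffnD oO (IH _ _ (diffn_pred kF) (dDG i)) (IH _ _ (diffn_pred kG) (dDF i)).
apply: diffn_eq => // x Ox.
by rewrite deriveM//; apply: diff_derivable; [exact: dF|exact: dG].
Qed.

(** The derivative - F^-2 dF is built from the reciprocal itself, to which the induction hypothesis
    applies at the lower order. The same device serves in [diffn_sqrt]. *)
Lemma diffnV k O F : open O -> (forall x, O x -> F x != 0) -> diffn k O F ->
  diffn k O (fun x => (F x)^-1).
Proof.
move=> oO F0; elim: k => // k IH kF; have [dF dDF] := kF; split => [x Ox|i].
  by apply: differentiableV; [exact: dF|exact: F0].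
have IHk := IH (diffn_pred kF).
have := diffnM oO (diffn_cst k (-1) oO) (diffnM oO (diffnM oO IHk IHk) (dDF i)).
apply: diffn_eq => // x Ox.
rewrite [RHS]deriveV ?F0//; last by apply: diff_derivable; exact: dF.
by rewrite mulN1r scaleNr expr2 invfM.
Qed.

Lemma diffn_sqrt k O F : open O -> (forall x, O x -> 0 < F x) -> diffn k O F ->
  diffn k O (fun x => Num.sqrt (F x)).
Proof.
move=> oO F0.
have ds x : O x -> differentiable (@Num.sqrt R) (F x).
  move=> Ox; apply/derivable1_diffP.
  by have [] := is_derive1_sqrt (F0 _ Ox).
elim: k => // k IH kF; have [dF dDF] := kF.
have dsF x : O x -> differentiable (fun x => Num.sqrt (F x)) x.
  by move=> Ox; apply: differentiable_comp; [exact: dF|exact: ds].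
split => // i.
have IHk := IH (diffn_pred kF).
have sp x : O x -> Num.sqrt (F x) != 0 by move=> Ox; rewrite gt_eqF// sqrtr_gt0 F0.
have := diffnM oO (diffn_cst k (2^-1) oO) (diffnM oO (diffnV oO sp IHk) (dDF i)).
apply: diffn_eq => // x Ox.
rewrite (deriveE _ (dsF _ Ox)) diff_comp//=; [|exact: dF|exact: ds].
rewrite (deriveE _ (dF _ Ox)).
have [dd E] := is_derive1_sqrt (F0 _ Ox).
rewrite deriv1E//= derive1E E.
by rewrite /cst mulrA -invfM mulrC.
Qed.

Lemma smooth_open_diffn k O F : smooth_open O F -> diffn k O F.
Proof.
elim: k F => // k IH F sF; split; first by move=> x; exact: (sF [::]).
(* [iter_partial] applies its last index first, while [diffn] peels off the innermost derivative,
   hence [rcons]. *)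
move=> i; apply: IH => s x Ox.
by have := sF (rcons s i) x Ox; rewrite /iter_partial foldr_rcons.
Qed.
End DiffN.

(** * Calculus in a chart *)

Section Charts.
Variables (R : realType) (n : nat) (M : bmanifold R n) (c : charts M).
Local Notation V := 'rV[R]_n.+1.
Implicit Types (f h : M -> R) (p q : M) (i j : 'I_n.+1).

(** Local extensions make the calculus on open sets available at boundary points. A finite order is
    tracked because a derivative then simply lowers it by one. *)
Definition chart_diff k f : Prop := forall p, cdom c p ->
  exists (O : set V) (F : V -> R), [/\ open O, O (cmap c p), diffn k O F &
    forall q, cdom c q -> O (cmap c q) -> F (cmap c q) = f q].

Lemma cinv_img y : (cmap c @` cdom c) y -> cdom c (cinv c y) /\ cmap c (cinv c y) = y.
Proof. by move=> [q Dq <-]; rewrite cmapK. Qed.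

Lemma cmap_ge0 p : cdom c p -> 0 <= cmap c p 0 ord0.
Proof.
move=> Dp; have [ O _ E] := @cimg_open _ _ _ c.
have : (cmap c @` cdom c) (cmap c p) by exists p.
by rewrite E => -[].
Qed.

(** From an interior point every direction is allowed; from a boundary point, those that do not
    point outward. *)
Lemma near_ray_img p (v : V) : cdom c p -> 0 < cmap c p 0 ord0 \/ 0 <= v 0 ord0 ->
  exists2 r : R, 0 < r & forall t, 0 <= t <= r -> (cmap c @` cdom c) (cmap c p + t *: v).
Proof.
move=> Dp Hv; have [ O oO E] := @cimg_open _ _ _ c.
have Op : O (cmap c p).
  have : (cmap c @` cdom c) (cmap c p) by exists p.
  by rewrite E => -[].
have [r r0 Hr] := near_line v (open_nbhs_nbhs (conj oO Op)).
have [r' r'0 Hr'] : exists2 r : R, 0 < r & forall t, 0 <= t <= r ->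
    0 <= (cmap c p + t *: v) 0 ord0.
  case: Hv => Hv; last first.
    exists 1 => // t /andP[t0 _]; rewrite !mxE addr_ge0 ?mulr_ge0// cmap_ge0//.
  have v0 : 0 < `|v 0 ord0| + 1 by rewrite ltr_wpDl.
  exists (cmap c p 0 ord0 / (`|v 0 ord0| + 1)); first by rewrite divr_gt0.
  move=> t /andP[t0]; rewrite ler_pdivlMr// => tr; rewrite !mxE.
  have := ler_norm (- v 0 ord0); rewrite normrN; nra.
exists (Num.min r r'); first by rewrite lt_min r0.
move=> t /andP[t0]; rewrite le_min => /andP[tr tr']; rewrite E; split.
  by apply: Hr; rewrite ger0_norm.
by apply: Hr'; rewrite t0.
Qed.

Lemma basis_vec_ge0 i : 0 <= basis_vec R i 0 ord0.
Proof. by rewrite mxE ler0n. Qed.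

(** The vector e_i does not point outward, so the forward quotient stays in the chart image, where f
    and its extension agree. This is the bridge from [partial] to ordinary derivatives. *)
Lemma partialE (O : set V) (F : V -> R) f p i : cdom c p -> open O -> O (cmap c p) ->
  differentiable F (cmap c p) ->
  (forall q, cdom c q -> O (cmap c q) -> F (cmap c q) = f q) ->
  partial c i f p = 'D_(basis_vec R i) F (cmap c p).
Proof.
move=> Dp oO Op dF Ff; set e := basis_vec R i.
have [r r0 Hr] := near_ray_img Dp (or_intror (basis_vec_ge0 i)).
have [r' r'0 Hr'] := near_line e (open_nbhs_nbhs (conj oO Op)).
have dd : derivable F (cmap c p) e by exact: diff_derivable.
have cd : (fun t : R => t^-1 *: ((F \o shift (cmap c p)) (t *: e) - F (cmap c p))) @ 0^'+
    --> 'D_e F (cmap c p).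
  move=> A /dd /nbhs_ballP[d /= d0 dA]; exists d => //= y yd y0.
  by apply: dA => //; rewrite gt_eqF.
rewrite /partial; apply: cvg_lim => //.
apply: cvg_trans cd; apply: near_eq_cvg; near=> t.
have t0 : 0 < t by [].
have tr : t <= r by near: t; exact: nbhs_right_le.
have tr' : t <= r' by near: t; exact: nbhs_right_le.
have [|Dq qE] := @cinv_img (cmap c p + t *: e); first by apply: Hr; rewrite ltW.
rewrite /= -(Ff p)// -(Ff _ Dq) qE; first by rewrite (addrC (cmap c p)).
by apply: Hr'; rewrite ger0_norm// ltW.
Unshelve. all: by end_near. Qed.

Lemma partial_eq f h p i : cdom c p -> (forall q, cdom c q -> f q = h q) ->
  partial c i f p = partial c i h p.
Proof.
move=> Dp fh; rewrite /partial fh//.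
have [r r0 Hr] := near_ray_img Dp (or_intror (basis_vec_ge0 i)).
suff E : \forall t \near (0 : R)^'+,
    t^-1 * (f (cinv c (cmap c p + t *: basis_vec R i)) - h p) =
    t^-1 * (h (cinv c (cmap c p + t *: basis_vec R i)) - h p).
  by congr (lim _); rewrite eqEsubset; split; apply: near_eq_cvg => //; apply: filterS E.
near=> t; have t0 : 0 < t by [].
rewrite fh//; have [|//] := @cinv_img (cmap c p + t *: basis_vec R i).
by apply: Hr; rewrite ltW//=; near: t; exact: nbhs_right_le.
Unshelve. all: by end_near. Qed.

(** For i <> 0 the quotient is evaluated at boundary points only. This is what allows boundary
    conditions, and the field [nu], to be differentiated along the boundary. *)
Lemma partial_eq_boundary f h p i : boundary_pt c p -> i != ord0 ->
  (forall q, boundary_pt c q -> f q = h q) -> partial c i f p = partial c i h p.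
Proof.
move=> bp i0 fh; have [Dp p0] := bp; rewrite /partial fh//.
have [r r0 Hr] := near_ray_img Dp (or_intror (basis_vec_ge0 i)).
suff E : \forall t \near (0 : R)^'+,
    t^-1 * (f (cinv c (cmap c p + t *: basis_vec R i)) - h p) =
    t^-1 * (h (cinv c (cmap c p + t *: basis_vec R i)) - h p).
  by congr (lim _); rewrite eqEsubset; split; apply: near_eq_cvg => //; apply: filterS E.
near=> t; have t0 : 0 < t by [].
rewrite fh//; have [|Dq qE] := @cinv_img (cmap c p + t *: basis_vec R i).
  by apply: Hr; rewrite ltW//=; near: t; exact: nbhs_right_le.
by split => //; rewrite qE !mxE p0 (eq_sym ord0) (negbTE i0) mulr0 addr0.
Unshelve. all: by end_near. Qed.

Lemma smooth_on_chart_diff k f :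
  smooth_on (cmap c @` cdom c) (f \o cinv c) -> chart_diff k f.
Proof.
move=> sf p Dp; have [|Z [F [oZ Zp sF FE]]] := sf (cmap c p); first by exists p.
exists Z, F; split => //; first exact: smooth_open_diffn.
by move=> q Dq Zq; rewrite FE//=; [rewrite cmapK|exists q].
Qed.

Lemma smooth_chart_diff k f : smooth f -> chart_diff k f.
Proof. by move=> sf; apply: smooth_on_chart_diff; exact: sf. Qed.

Lemma chart_diff_partial k f i : chart_diff k.+1 f -> chart_diff k (partial c i f).
Proof.
move=> df p Dp; have [ O [F [oO Op [dF dDF] FE]]] := df p Dp.
exists O, ('D_(basis_vec R i) F); split=> [ | | |q Dq Oq] //.
  exact: dDF.
by rewrite (partialE _ Dq oO Oq (dF _ Oq) FE).
Qed.

Lemma chart_diff_pred k f : chart_diff k.+1 f -> chart_diff k f.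
Proof.
move=> df p Dp; have [ O [F [oO Op dF FE]]] := df p Dp.
by exists O, F; split => //; exact: diffn_pred.
Qed.

Lemma chart_diff_eq k f h : (forall q, cdom c q -> f q = h q) ->
  chart_diff k f -> chart_diff k h.
Proof.
move=> fh df p Dp; have [ O [F [oO Op dF FE]]] := df p Dp.
by exists O, F; split => // q Dq Oq; rewrite FE ?fh.
Qed.

Lemma chart_diff_cst k (a : R) : chart_diff k (fun=> a).
Proof.
move=> p Dp; exists setT, (cst a); split => //; first exact: openT.
exact/diffn_cst/openT.
Qed.

Lemma chart_diff2 k f h p : chart_diff k f -> chart_diff k h -> cdom c p ->
  exists O F H, [/\ open O, O (cmap c p), diffn k O F, diffn k O H &
    forall q, cdom c q -> O (cmap c q) -> F (cmap c q) = f q /\ H (cmap c q) = h q].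
Proof.
move=> df dh Dp; have [ O [F [oO Op dF FE]]] := df p Dp.
have [ O' [H [oO' Op' dH HE]]] := dh p Dp.
exists (O `&` O'), F, H; split => //; first exact: openI.
- exact: diffn_sub dF.
- exact: diffn_sub dH.
- by move=> q Dq [ Oq Oq']; rewrite FE ?HE.
Qed.

Lemma chart_diffD k f h : chart_diff k f -> chart_diff k h ->
  chart_diff k (fun q => f q + h q).
Proof.
move=> df dh p Dp; have [ O [F [H [oO Op dF dH E]]]] := chart_diff2 df dh Dp.
exists O, (fun x => F x + H x); split => //; first exact: diffnD.
by move=> q Dq Oq; have [-> ->] := E q Dq Oq.
Qed.

Lemma chart_diffM k f h : chart_diff k f -> chart_diff k h ->
  chart_diff k (fun q => f q * h q).
Proof.
move=> df dh p Dp; have [ O [F [H [oO Op dF dH E]]]] := chart_diff2 df dh Dp.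
exists O, (fun x => F x * H x); split => //; first exact: diffnM.
by move=> q Dq Oq; have [-> ->] := E q Dq Oq.
Qed.

Lemma partialD f h p i : chart_diff 1 f -> chart_diff 1 h -> cdom c p ->
  partial c i (fun q => f q + h q) p = partial c i f p + partial c i h p.
Proof.
move=> df dh Dp; have [ O [F [H [oO Op [dF _] [dH _] E]]]] := chart_diff2 df dh Dp.
have dFp := dF _ Op; have dHp := dH _ Op.
rewrite (partialE i Dp oO Op dFp (fun q Dq Oq => (E q Dq Oq).1)).
rewrite (partialE i Dp oO Op dHp (fun q Dq Oq => (E q Dq Oq).2)).
rewrite (@partialE O (F + H) _ p i)//.
- by rewrite deriveD//; exact: diff_derivable.
- exact: differentiableD.
- by move=> q Dq Oq; rewrite fctE; have [-> ->] := E q Dq Oq.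
Qed.

Lemma partialM f h p i : chart_diff 1 f -> chart_diff 1 h -> cdom c p ->
  partial c i (fun q => f q * h q) p = partial c i f p * h p + f p * partial c i h p.
Proof.
move=> df dh Dp; have [ O [F [H [oO Op [dF _] [dH _] E]]]] := chart_diff2 df dh Dp.
have dFp := dF _ Op; have dHp := dH _ Op.
rewrite (partialE i Dp oO Op dFp (fun q Dq Oq => (E q Dq Oq).1)).
rewrite (partialE i Dp oO Op dHp (fun q Dq Oq => (E q Dq Oq).2)).
rewrite (@partialE O (F * H) _ p i)//.
- rewrite deriveM; [|exact: diff_derivable..].
  have [-> ->] := E p Dp Op.
  by rewrite addrC; congr (_ + _); rewrite [LHS]mulrC.
- exact: differentiableM.
- by move=> q Dq Oq; rewrite fctE; have [-> ->] := E q Dq Oq.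
Qed.

Lemma partial_cst (a : R) p i : cdom c p -> partial c i (fun=> a) p = 0.
Proof.
move=> Dp; rewrite (@partialE setT (cst a) _ p i)//.
- by rewrite derive_cst.
- exact: openT.
Qed.

Lemma partial_comm f p i j : chart_diff 2 f -> cdom c p ->
  partial c i (partial c j f) p = partial c j (partial c i f) p.
Proof.
move=> df Dp; have [ O [F [oO Op [dF dDF] FE]]] := df p Dp.
have H k q : cdom c q -> O (cmap c q) ->
    'D_(basis_vec R k) F (cmap c q) = partial c k f q.
  by move=> Dq Oq; rewrite (partialE _ Dq oO Oq (dF _ Oq) FE).
rewrite (partialE i Dp oO Op (proj1 (dDF j) _ Op) (H j)).
rewrite (partialE j Dp oO Op (proj1 (dDF i) _ Op) (H i)).
apply: derive_comm; [|exact: (proj1 (dDF j))|exact: (proj1 (dDF i))].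
by have := open_nbhs_nbhs (conj oO Op); exact: filterS.
Qed.

(** The extension F agrees with f only on the chart image and may vanish outside it. Its continuity,
    which requires order at least 1, gives a smaller neighbourhood where it does not. *)
Lemma chart_diffV k f : (forall q, cdom c q -> f q != 0) -> chart_diff k.+1 f ->
  chart_diff k.+1 (fun q => (f q)^-1).
Proof.
move=> f0 df p Dp; have [ O [F [oO Op dF FE]]] := df p Dp.
have Fp0 : F (cmap c p) != 0 by rewrite FE// f0.
have cF : {for cmap c p, continuous F}.
  by apply: differentiable_continuous; exact: (proj1 dF).
have := open_nbhs_nbhs (conj oO Op) => nO.
have : \forall y \near cmap c p, O y /\ F y != 0.
  apply: filterI => //; exact: (cvgr_neq0 _ cF).
rewrite /prop_near1 nbhsE => -[ O' [oO' O'p] O'O].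
exists O', (fun x => (F x)^-1); split => //.
- apply: diffnV => //; first by move=> y /O'O[].
  by apply: diffn_sub dF => y /O'O[].
- by move=> q Dq /O'O[ Oq _]; rewrite FE.
Qed.

Lemma chart_diff_sqrt k f : (forall q, cdom c q -> 0 < f q) -> chart_diff k.+1 f ->
  chart_diff k.+1 (fun q => Num.sqrt (f q)).
Proof.
move=> f0 df p Dp; have [ O [F [oO Op dF FE]]] := df p Dp.
have Fp0 : 0 < F (cmap c p) by rewrite FE// f0.
have cF : {for cmap c p, continuous F}.
  by apply: differentiable_continuous; exact: (proj1 dF).
have := open_nbhs_nbhs (conj oO Op) => nO.
have : \forall y \near cmap c p, O y /\ 0 < F y.
  apply: filterI => //; exact: (cvgr_gt _ cF).
rewrite /prop_near1 nbhsE => -[ O' [oO' O'p] O'O].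
exists O', (fun x => Num.sqrt (F x)); split => //.
- apply: diffn_sqrt => //; first by move=> y /O'O[].
  by apply: diffn_sub dF => y /O'O[].
- by move=> q Dq /O'O[ Oq _]; rewrite FE.
Qed.

Lemma chart_diff_sum k (I : Type) (r : seq I) (P : pred I) (f : I -> M -> R) :
  (forall l, P l -> chart_diff k (f l)) ->
  chart_diff k (fun q => \sum_(l <- r | P l) f l q).
Proof.
move=> df; elim: r => [|l r IH].
  by apply: chart_diff_eq (chart_diff_cst k 0) => q _; rewrite big_nil.
have [Pl|Pl] := boolP (P l).
  by apply: chart_diff_eq (chart_diffD (df l Pl) IH) => q _; rewrite big_cons Pl.
by apply: chart_diff_eq IH => q _; rewrite big_cons (negbTE Pl).
Qed.

Lemma chart_diff_prod k (I : Type) (r : seq I) (f : I -> M -> R) :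
  (forall l, chart_diff k (f l)) -> chart_diff k (fun q => \prod_(l <- r) f l q).
Proof.
move=> df; elim: r => [|l r IH].
  by apply: chart_diff_eq (chart_diff_cst k 1) => q _; rewrite big_nil.
by apply: chart_diff_eq (chart_diffM (df l) IH) => q _; rewrite big_cons.
Qed.

Lemma partial_sum (I : Type) (r : seq I) (f : I -> M -> R) p i :
  (forall l, chart_diff 1 (f l)) -> cdom c p ->
  partial c i (fun q => \sum_(l <- r) f l q) p = \sum_(l <- r) partial c i (f l) p.
Proof.
move=> df Dp; elim: r => [|l r IH].
  rewrite big_nil -[RHS](partial_cst 0 i Dp); apply: partial_eq => // q _.
  by rewrite big_nil.
rewrite big_cons -IH -partialD//; last by apply: chart_diff_sum.
by apply: partial_eq => // q _; rewrite big_cons.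
Qed.
End Charts.

(** * The Levi-Civita connection in matrix form *)

Lemma trmxD (R : nmodType) m n (A B : 'M[R]_(m, n)) : (A + B)^T = A^T + B^T.
Proof. by apply/matrixP => i j; rewrite !mxE. Qed.

Lemma trmxN (R : zmodType) m n (A : 'M[R]_(m, n)) : (- A)^T = - A^T.
Proof. by apply/matrixP => i j; rewrite !mxE. Qed.

Lemma trmxB (R : zmodType) m n (A B : 'M[R]_(m, n)) : (A - B)^T = A^T - B^T.
Proof. by apply/matrixP => i j; rewrite !mxE. Qed.

Lemma mxaddE (R : nmodType) m n (A B : 'M[R]_(m, n)) i j : (A + B) i j = A i j + B i j.
Proof. by rewrite mxE. Qed.

Lemma mxoppE (R : zmodType) m n (A : 'M[R]_(m, n)) i j : (- A) i j = - A i j.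
Proof. by rewrite mxE. Qed.

Lemma mxscaleE (R : pzRingType) m n k (A : 'M[R]_(m, n)) i j : (k *: A) i j = k * A i j.
Proof. by rewrite mxE. Qed.

Definition mxDE := (mxaddE, mxoppE).

Ltac mxring := rewrite !mxDE; ring.

(** Read s as the metric, a and b as the Christoffel matrices in the directions l and k, x as the
    l-derivative of b and y as the k-derivative of a: the right-hand side is the difference of two
    mixed second derivatives of s. *)
Lemma curvature_algebra (R : comNzRingType) m (a b x y s : 'M[R]_m) :
  (x - y + a *m b - b *m a)^T *m s + s *m (x - y + a *m b - b *m a) =
  x^T *m s + b^T *m (a^T *m s + s *m a) + ((a^T *m s + s *m a) *m b + s *m x)
  - (y^T *m s + a^T *m (b^T *m s + s *m b) + ((b^T *m s + s *m b) *m a + s *m y)).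
Proof.
rewrite !(trmxD, trmxN) !trmx_mul !(mulmxDl, mulmxDr, mulNmx, mulmxN) !mulmxA.
by apply/matrixP => i j; mxring.
Qed.

(** * Entrywise calculus of matrix-valued functions *)

Section MatrixCalculus.
Variables (R : realType) (n : nat) (M : bmanifold R n) (c : charts M).

Definition mdiff a b k (A : M -> 'M[R]_(a, b)) : Prop :=
  forall i j, chart_diff c k (fun q => A q i j).

Definition mpart a b l (A : M -> 'M[R]_(a, b)) (p : M) : 'M[R]_(a, b) :=
  \matrix_(i, j) partial c l (fun q => A q i j) p.

Lemma mdiff_pred a b k (A : M -> 'M[R]_(a, b)) : mdiff k.+1 A -> mdiff k A.
Proof. by move=> dA i j; exact: chart_diff_pred. Qed.

Lemma mdiff_eq a b k (A B : M -> 'M[R]_(a, b)) :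
  (forall q, cdom c q -> A q = B q) -> mdiff k A -> mdiff k B.
Proof. by move=> AB dA i j; apply: chart_diff_eq (dA i j) => q Dq; rewrite AB. Qed.

Lemma mpart_eq a b l (A B : M -> 'M[R]_(a, b)) p : cdom c p ->
  (forall q, cdom c q -> A q = B q) -> mpart l A p = mpart l B p.
Proof.
by move=> Dp AB; apply/matrixP => i j; rewrite !mxE; apply: partial_eq => // q Dq; rewrite AB.
Qed.

Lemma mdiff_mpart a b k l (A : M -> 'M[R]_(a, b)) : mdiff k.+1 A -> mdiff k (mpart l A).
Proof.
move=> dA i j; apply: chart_diff_eq (chart_diff_partial l (dA i j)) => q Dq.
by rewrite mxE.
Qed.

Lemma mdiff_tr a b k (A : M -> 'M[R]_(a, b)) : mdiff k A -> mdiff k (fun q => (A q)^T).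
Proof. by move=> dA i j; apply: chart_diff_eq (dA j i) => q _; rewrite mxE. Qed.

Lemma mdiffD a b k (A B : M -> 'M[R]_(a, b)) : mdiff k A -> mdiff k B ->
  mdiff k (fun q => A q + B q).
Proof.
move=> dA dB i j; apply: chart_diff_eq (chart_diffD (dA i j) (dB i j)) => q _.
by rewrite mxE.
Qed.

Lemma mdiffZ a b k (f : M -> R) (A : M -> 'M[R]_(a, b)) : chart_diff c k f -> mdiff k A ->
  mdiff k (fun q => f q *: A q).
Proof.
move=> df dA i j; apply: chart_diff_eq (chart_diffM df (dA i j)) => q _.
by rewrite mxE.
Qed.

Lemma mdiffN a b k (A : M -> 'M[R]_(a, b)) : mdiff k A -> mdiff k (fun q => - A q).
Proof.
move=> dA; apply: (@mdiff_eq _ _ _ (fun q => -1 *: A q)) => [q _|].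
  by rewrite scaleN1r.
by apply: mdiffZ => //; exact: chart_diff_cst.
Qed.

Lemma mdiffB a b k (A B : M -> 'M[R]_(a, b)) : mdiff k A -> mdiff k B ->
  mdiff k (fun q => A q - B q).
Proof. by move=> dA dB; exact: mdiffD dA (mdiffN dB). Qed.

Lemma mdiffM a b d k (A : M -> 'M[R]_(a, b)) (B : M -> 'M[R]_(b, d)) :
  mdiff k A -> mdiff k B -> mdiff k (fun q => A q *m B q).
Proof.
move=> dA dB i j.
apply: chart_diff_eq (@chart_diff_sum _ _ _ c k _ (index_enum _) predT
  (fun l q => A q i l * B q l j) _) => [q _|l _]; first by rewrite mxE.
exact: chart_diffM.
Qed.

Lemma mpart_tr a b l (A : M -> 'M[R]_(a, b)) p : cdom c p ->
  mpart l (fun q => (A q)^T) p = (mpart l A p)^T.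
Proof.
move=> Dp; apply/matrixP => i j; rewrite !mxE; apply: partial_eq => // q _.
by rewrite mxE.
Qed.

Lemma mpart_cst a b l (A : 'M[R]_(a, b)) p : cdom c p -> mpart l (fun=> A) p = 0.
Proof. by move=> Dp; apply/matrixP => i j; rewrite !mxE partial_cst. Qed.

Lemma mpartD a b l (A B : M -> 'M[R]_(a, b)) p : mdiff 1 A -> mdiff 1 B -> cdom c p ->
  mpart l (fun q => A q + B q) p = mpart l A p + mpart l B p.
Proof.
move=> dA dB Dp; apply/matrixP => i j; rewrite !mxE.
rewrite -partialD//.
by apply: partial_eq => // q _; rewrite mxE.
Qed.

Lemma mpartZ a b l (f : M -> R) (A : M -> 'M[R]_(a, b)) p :
  chart_diff c 1 f -> mdiff 1 A -> cdom c p ->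
  mpart l (fun q => f q *: A q) p = partial c l f p *: A p + f p *: mpart l A p.
Proof.
move=> df dA Dp; apply/matrixP => i j; rewrite !mxE.
rewrite -partialM//.
by apply: partial_eq => // q _; rewrite mxE.
Qed.

Lemma mpartN a b l (A : M -> 'M[R]_(a, b)) p : mdiff 1 A -> cdom c p ->
  mpart l (fun q => - A q) p = - mpart l A p.
Proof.
move=> dA Dp; rewrite (@mpart_eq _ _ l _ (fun q => -1 *: A q))//; last first.
  by move=> q _; rewrite scaleN1r.
rewrite (mpartZ l (@chart_diff_cst _ _ _ c 1 (-1)) dA Dp) partial_cst//.
by rewrite scale0r add0r scaleN1r.
Qed.

Lemma mpartB a b l (A B : M -> 'M[R]_(a, b)) p : mdiff 1 A -> mdiff 1 B -> cdom c p ->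
  mpart l (fun q => A q - B q) p = mpart l A p - mpart l B p.
Proof. by move=> dA dB Dp; rewrite mpartD ?mpartN//; exact: mdiffN. Qed.

Lemma mpartM a b d l (A : M -> 'M[R]_(a, b)) (B : M -> 'M[R]_(b, d)) p :
  mdiff 1 A -> mdiff 1 B -> cdom c p ->
  mpart l (fun q => A q *m B q) p = mpart l A p *m B p + A p *m mpart l B p.
Proof.
move=> dA dB Dp; apply/matrixP => i j; rewrite !mxE -big_split /=.
rewrite (@partial_eq _ _ _ c _ (fun q => \sum_m A q i m * B q m j))//; last first.
  by move=> q _; rewrite mxE.
rewrite partial_sum//; last by move=> m; exact: chart_diffM.
by apply: eq_bigr => m _; rewrite partialM// !mxE.
Qed.

Lemma partial_trace a l (A : M -> 'M[R]_a) p : mdiff 1 A -> cdom c p ->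
  partial c l (fun q => \tr (A q)) p = \tr (mpart l A p).
Proof.
move=> dA Dp; rewrite /mxtrace partial_sum//.
by apply: eq_bigr => i _; rewrite mxE.
Qed.

Lemma partial_entry a b l (A : M -> 'M[R]_(a, b)) p i j :
  partial c l (fun q => A q i j) p = mpart l A p i j.
Proof. by rewrite mxE. Qed.

Lemma chart_diff_det a k (A : M -> 'M[R]_a) : mdiff k A -> chart_diff c k (fun q => \det (A q)).
Proof.
move=> dA; rewrite /determinant.
apply: chart_diff_sum => s _; apply: chart_diffM; first exact: chart_diff_cst.
exact: chart_diff_prod.
Qed.

Lemma mdiff_inv a k (A : M -> 'M[R]_a) : (forall q, cdom c q -> A q \in unitmx) ->
  mdiff k.+1 A -> mdiff k.+1 (fun q => invmx (A q)).
Proof.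
move=> uA dA.
apply: (@mdiff_eq _ _ _ (fun q => (\det (A q))^-1 *: \adj (A q))) => [q Dq|].
  by rewrite /invmx uA.
apply: mdiffZ.
  apply: chart_diffV; last exact: chart_diff_det.
  by move=> q /uA; rewrite unitmxE unitfE.
move=> i j; apply: (@chart_diff_eq _ _ _ _ _ (fun q => (-1) ^+ (j + i) *
    \det (row' j (col' i (A q))))) => [q _|]; first by rewrite mxE.
apply: chart_diffM; first exact: chart_diff_cst.
apply: chart_diff_det => i' j'.
by apply: chart_diff_eq (dA (lift j i') (lift i j')) => q _; rewrite !mxE.
Qed.
End MatrixCalculus.

(** * Christoffel matrices, covariant derivative and curvature *)

Section Geometry.
Variables (R : realType) (n : nat) (M : bmanifold R n) (g : riem_metric M).
Variable c : charts M.
Implicit Types (f h u : M -> R) (p q : M).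
Local Notation G := (ginv g c).
Local Notation gc := (gmat g c).
Local Notation D := (cdom c).

Definition dform f p : 'rV[R]_n.+1 := \row_i partial c i f p.

(* [a *m chr k] has components [a_m Gamma^m_(k i)], so that the covariant
   derivative of a covector field [a], a row, is [nabla k a] below. *)
Definition chr k p : 'M[R]_n.+1 := \matrix_(m, i) christoffel g c m k i p.

Lemma metric_unit p : D p -> gc p \in unitmx.
Proof.
move=> Dp; rewrite -row_free_unit -kermx_eq0; apply: contraT => nz.
have [v vk v0] : exists2 v : 'rV_n.+1, (v <= kermx (gc p))%MS & v != 0.
  by exists (nz_row (kermx (gc p))); rewrite ?nz_row_sub ?nz_row_eq0.
have := gmat_pos g Dp v0; move/sub_kermxP: vk => ->.
by rewrite mul0mx mxE ltxx.
Qed.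

Lemma ginv_sym p : D p -> (G p)^T = G p.
Proof. by move=> Dp; rewrite /ginv trmx_inv gmat_sym. Qed.

Lemma mulmx_ginv p : D p -> gc p *m G p = 1%:M.
Proof. by move=> Dp; rewrite mulmxV// metric_unit. Qed.

Lemma ginv_mulmx p : D p -> G p *m gc p = 1%:M.
Proof. by move=> Dp; rewrite mulVmx// metric_unit. Qed.

Lemma metric_diff k : mdiff c k gc.
Proof. by move=> i j; apply: smooth_on_chart_diff; exact: gmat_smooth. Qed.

Lemma ginv_diff k : mdiff c k G.
Proof. by apply: mdiff_pred; apply: mdiff_inv; [exact: metric_unit|exact: metric_diff]. Qed.

Lemma dform_diff k f : chart_diff c k.+1 f -> mdiff c k (dform f).
Proof.
move=> df i j; apply: chart_diff_eq (chart_diff_partial j df) => q _.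
by rewrite mxE.
Qed.

(** Twice the Christoffel symbols of the first kind, with the lowered index as row index. *)
Let E k q : 'M[R]_n.+1 := \matrix_(l, i)
  (partial c k (fun q => gc q i l) q + partial c i (fun q => gc q k l) q
     - partial c l (fun q => gc q k i) q).

Let chrE k q : chr k q = 2^-1 *: (G q *m E k q).
Proof.
apply/matrixP => m i; rewrite !mxE; congr (_ * _).
by apply: eq_bigr => l _; rewrite !mxE.
Qed.

Lemma chr_diff k l : mdiff c l (chr k).
Proof.
apply: (@mdiff_eq _ _ _ _ _ _ _ (fun q => 2^-1 *: (G q *m E k q))) => [q _|].
  by rewrite chrE.
apply: mdiffZ; first exact: chart_diff_cst.
apply: mdiffM; first exact: ginv_diff.
have dg m i j : chart_diff c l (partial c m (fun q => gc q i j)).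
  by apply: chart_diff_partial; exact: metric_diff.
move=> i j; apply: (@chart_diff_eq _ _ _ _ _ (fun q =>
  (partial c k (fun q => gc q j i) q + partial c j (fun q => gc q k i) q) +
     (-1) * partial c i (fun q => gc q k j) q)) => [q _|].
  by rewrite mxE mulN1r.
apply: chart_diffD; first exact: chart_diffD.
by apply: chart_diffM => //; exact: chart_diff_cst.
Qed.

Lemma metric_symE p i j : D p -> gc p i j = gc p j i.
Proof. by move=> Dp; rewrite -[in RHS](gmat_sym g Dp) mxE. Qed.

Lemma partial_metric_sym p k i j : D p ->
  partial c k (fun q => gc q i j) p = partial c k (fun q => gc q j i) p.
Proof. by move=> Dp; apply: partial_eq => // q Dq; exact: metric_symE. Qed.

Lemma chr_sym p m k i : D p -> chr k p m i = chr i p m k.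
Proof.
move=> Dp; rewrite !mxE /christoffel; congr (_ * _); apply: eq_bigr => l _.
congr (_ * _); rewrite [X in X - _]addrC; congr (_ - _).
exact: partial_metric_sym.
Qed.

(** Lowering the index turns [chr k] into half of [E k], and symmetrizing [E k] leaves only the
    k-derivative of the metric. *)
Lemma metric_compat k p : D p ->
  mpart c k gc p = (chr k p)^T *m gc p + gc p *m chr k p.
Proof.
move=> Dp; have gC : gc p *m chr k p = 2^-1 *: E k p.
  by rewrite chrE -scalemxAr mulmxA mulmx_ginv// mul1mx.
have -> : (chr k p)^T *m gc p = (gc p *m chr k p)^T.
  by rewrite trmx_mul gmat_sym.
rewrite gC; apply/matrixP => i j; rewrite !mxE.
rewrite (partial_metric_sym k j i Dp) (partial_metric_sym j k i Dp).
rewrite (partial_metric_sym i k j Dp). lra.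
Qed.

Lemma ginv_compat k p : D p ->
  mpart c k G p = - (chr k p *m G p) - G p *m (chr k p)^T.
Proof.
move=> Dp.
have H : mpart c k gc p *m G p + gc p *m mpart c k G p = 0.
  rewrite -mpartM//; [|exact: metric_diff|exact: ginv_diff].
  rewrite (@mpart_eq _ _ _ _ _ _ _ _ (fun=> 1%:M))//; first exact: mpart_cst.
  exact: mulmx_ginv.
have -> : mpart c k G p = - (G p *m mpart c k gc p *m G p).
  rewrite -[LHS]mul1mx -(ginv_mulmx Dp) -!mulmxA.
  by move/eqP: H; rewrite addrC addr_eq0 => /eqP ->; rewrite mulmxN.
rewrite metric_compat// mulmxDr !mulmxDl !mulmxA ginv_mulmx// mul1mx.
by rewrite -[X in X + _]mulmxA mulmx_ginv// mulmx1 opprD addrC.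
Qed.

Definition nabla k (a : M -> 'rV[R]_n.+1) p : 'rV[R]_n.+1 := mpart c k a p - a p *m chr k p.

(** [ginv_compat] supplies exactly the Christoffel terms that turn the partial derivatives of the
    covectors into [nabla]. *)
Lemma partial_pairing k (a b : M -> 'rV[R]_n.+1) p : mdiff c 1 a -> mdiff c 1 b -> D p ->
  partial c k (fun q => (a q *m G q *m (b q)^T) 0 0) p =
  (nabla k a p *m G p *m (b p)^T) 0 0 + (a p *m G p *m (nabla k b p)^T) 0 0.
Proof.
move=> da db Dp; rewrite partial_entry mpartM//; last 2 first.
- by apply: mdiffM => //; exact: ginv_diff.
- exact: mdiff_tr.
rewrite mpartM//; last exact: ginv_diff.
rewrite mpart_tr// ginv_compat// /nabla trmxB trmx_mul.
rewrite !(mulmxBl, mulmxDl, mulmxBr, mulmxDr) !(mulmxN, mulNmx) !mulmxA.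
mxring.
Qed.

Lemma hessian_row k f p : D p -> row k (hessian g f c p) = nabla k (dform f) p.
Proof.
move=> Dp; apply/rowP => i; rewrite !mxE; congr (_ - _).
  by apply: partial_eq => // q _; rewrite mxE.
by apply: eq_bigr => m _; rewrite !mxE mulrC.
Qed.

Lemma hessian_sym f p : chart_diff c 2 f -> D p -> (hessian g f c p)^T = hessian g f c p.
Proof.
move=> df Dp; apply/matrixP => i j; rewrite !mxE partial_comm//; congr (_ - _).
apply: eq_bigr => m _; congr (_ * _).
by have := chr_sym m j i Dp; rewrite !mxE.
Qed.

Lemma hessian_diff k f : chart_diff c k.+2 f -> mdiff c k (hessian g f c).
Proof.
move=> df i j.
apply: (@chart_diff_eq _ _ _ _ _ (fun q => (nabla i (dform f) q) 0 j)) => [q Dq|].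
  by rewrite -hessian_row// mxE.
have := @mdiffB _ _ _ c _ _ k (mpart c i (dform f)) (fun q => dform f q *m chr i q).
move=> H; have := H _ _ 0 j; apply.
- by apply: mdiff_mpart; exact: dform_diff.
- apply: mdiffM; last exact: chr_diff.
  by apply: mdiff_pred; exact: dform_diff.
Qed.

(* The entry [(m, i)] is [dx^m (Rm (e_l, e_k) e_i)]. *)
Definition curv l k p : 'M[R]_n.+1 := mpart c l (chr k) p - mpart c k (chr l) p
  + chr l p *m chr k p - chr k p *m chr l p.

Lemma riemannE l k m i p : D p -> riemann g c m i l k p = curv l k p m i.
Proof.
move=> Dp; rewrite /riemann big_split sumrN !mxE -addrA; congr (_ + _).
  by congr (_ - _); apply: partial_eq => // q _; rewrite mxE.
by congr (_ - _); apply: eq_bigr => a _; rewrite !mxE.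
Qed.

Lemma mpart_comm a b i j (A : M -> 'M[R]_(a, b)) p : mdiff c 2 A -> D p ->
  mpart c i (mpart c j A) p = mpart c j (mpart c i A) p.
Proof.
move=> dA Dp; apply/matrixP => x y; rewrite [LHS]mxE [RHS]mxE.
transitivity (partial c i (partial c j (fun q => A q x y)) p).
  by apply: partial_eq => // q _; rewrite mxE.
rewrite partial_comm//; apply: partial_eq => // q _; by rewrite mxE.
Qed.

(** The mixed second derivatives of the metric commute. Expanded by [metric_compat], their
    difference is the lowered curvature plus its transpose. *)
Lemma curv_antisym l k p : D p -> (curv l k p)^T *m gc p + gc p *m curv l k p = 0.
Proof.
move=> Dp.
have dg := metric_diff 1; have dC i := chr_diff i 1.
have E2 i j : mpart c i (mpart c j gc) p =
   (mpart c i (chr j) p)^T *m gc p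
   + (chr j p)^T *m ((chr i p)^T *m gc p + gc p *m chr i p)
   + (((chr i p)^T *m gc p + gc p *m chr i p) *m chr j p
     + gc p *m mpart c i (chr j) p).
  have dCt : mdiff c 1 (fun q => (chr j q)^T) by exact: mdiff_tr.
  rewrite (@mpart_eq _ _ _ _ _ _ _ _
    (fun q => (chr j q)^T *m gc q + gc q *m chr j q))//; last first.
    by move=> q Dq; exact: metric_compat.
  rewrite mpartD//; [|exact: mdiffM..].
  by rewrite !mpartM// mpart_tr// -metric_compat.
have := mpart_comm l k (metric_diff 2) Dp; rewrite !E2 /curv => /eqP.
by rewrite -subr_eq0 => /eqP <-; exact: curvature_algebra.
Qed.

End Geometry.

(** * The Bochner formula *)

(** Read w as df, dk and dl as its derivatives in the directions k and l, t as the mixed second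
    derivative, and a, b, x, y as in [curvature_algebra]. *)
Lemma nabla2_algebra (R : comNzRingType) m (t w dk dl : 'rV[R]_m) (a b x y : 'M[R]_m) :
  t - (dl *m b + w *m x) - (dk - w *m b) *m a
    - (t - (dk *m a + w *m y) - (dl - w *m a) *m b)
  = - (w *m (x - y + a *m b - b *m a)).
Proof.
rewrite !(mulmxBl, mulmxBr, mulmxDl, mulmxDr) !mulmxA.
by apply/matrixP => i j; mxring.
Qed.

Section Bochner.
Variables (R : realType) (n : nat) (M : bmanifold R n) (g : riem_metric M).
Variable c : charts M.
Implicit Types (f h u : M -> R) (p q : M).
Local Notation G := (ginv g c).
Local Notation gc := (gmat g c).
Local Notation D := (cdom c).
Local Notation C := (chr g c).
Local Notation nab := (nabla g c).
Local Notation hess f := (hessian g f c).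

(* nabla_(e_l) (D^2 f) *)
Definition covhess f l p : 'M[R]_n.+1 :=
  mpart c l (hess f) p - (C l p)^T *m hess f p - hess f p *m C l p.

Lemma covhess_sym f l p : chart_diff c 3 f -> D p -> (covhess f l p)^T = covhess f l p.
Proof.
move=> df Dp; have df2 := chart_diff_pred df.
rewrite /covhess !trmxB !trmx_mul trmxK hessian_sym// addrAC -mpart_tr//.
by congr (_ - _ - _); apply: mpart_eq => // q Dq; exact: hessian_sym.
Qed.

Lemma gradientE f p : D p -> gradient g f c p = dform c f p *m G p.
Proof.
move=> Dp; apply/rowP => i; rewrite !mxE; apply: eq_bigr => j _.
by rewrite -[in LHS](ginv_sym g Dp) !mxE mulrC.
Qed.

Lemma inner_gradient f h p : D p ->
  inner g c p (gradient g f c p) (gradient g h c p) =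
  (dform c f p *m G p *m (dform c h p)^T) 0 0.
Proof.
move=> Dp; rewrite /inner !gradientE// trmx_mul ginv_sym// !mulmxA.
by rewrite -[X in X *m _]mulmxA mulmx_ginv// mulmx1.
Qed.

Lemma nabla_diff k f l : chart_diff c k.+2 f -> mdiff c k (nab l (dform c f)).
Proof.
move=> df; apply: mdiffB; first by apply: mdiff_mpart; exact: dform_diff.
apply: mdiffM; last exact: chr_diff.
by apply: mdiff_pred; exact: dform_diff.
Qed.

Lemma partial_laplacian f l p : chart_diff c 3 f -> D p ->
  partial c l (laplacian g f c) p = \tr (G p *m covhess f l p).
Proof.
move=> df Dp; have dH := hessian_diff g df.
rewrite /laplacian partial_trace//; last by apply: mdiffM => //; exact: ginv_diff.
rewrite mpartM//; last exact: ginv_diff.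
rewrite ginv_compat// /covhess !(mulmxBr, mulmxDl, mulmxN, mulNmx) !mulmxA.
rewrite !(mxtraceD, raddfN) /=.
rewrite -[\tr (C l p *m G p *m _)]mxtrace_mulC !mulmxA.
have -> : \tr (hess f p *m C l p *m G p) = \tr (G p *m hess f p *m C l p).
  by rewrite mxtrace_mulC !mulmxA.
ring.
Qed.

Lemma nabla2_comm f l k p : chart_diff c 3 f -> D p ->
  nab l (nab k (dform c f)) p - nab k (nab l (dform c f)) p
    = - (dform c f p *m curv g c l k p).
Proof.
move=> df Dp; have dw := dform_diff df.
have dw1 := mdiff_pred dw.
have H i j : nab i (nab j (dform c f)) p =
   mpart c i (mpart c j (dform c f)) p - (mpart c i (dform c f) p *m C j p
   + dform c f p *m mpart c i (C j) p)
   - (mpart c j (dform c f) p - dform c f p *m C j p) *m C i p.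
  rewrite {1}/nabla; congr (_ - _).
  rewrite mpartB//; [|exact: mdiff_mpart|apply: mdiffM => //; exact: chr_diff].
  by rewrite mpartM//; exact: chr_diff.
rewrite !H (mpart_comm l k dw Dp) /curv.
exact: nabla2_algebra.
Qed.

Lemma covhess_row f l k p : chart_diff c 3 f -> D p ->
  row k (covhess f l p) = nab l (nab k (dform c f)) p - row k ((C l p)^T *m hess f p).
Proof.
move=> df Dp; rewrite /covhess 2!raddfB /= addrAC {1}/nabla; congr (_ - _ - _).
  apply/rowP => j; rewrite !mxE; apply: partial_eq => // q Dq.
  by rewrite -hessian_row// [RHS]mxE.
by rewrite row_mul hessian_row.
Qed.

(** Ricci identity: the Christoffel term by which [covhess_row] differs from the iterated [nabla] is
    symmetric in l and k, the connection being torsion free, so only the curvature survives the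
    exchange. *)
Lemma covhess_comm f l k j p : chart_diff c 3 f -> D p ->
  covhess f l p k j = covhess f k p l j - (dform c f p *m curv g c l k p) 0 j.
Proof.
move=> df Dp.
have rowE a b : covhess f a p b j =
    nab a (nab b (dform c f)) p 0 j - row b ((C a p)^T *m hess f p) 0 j.
  transitivity (row b (covhess f a p) 0 j); first by rewrite [RHS]mxE.
  by rewrite covhess_row// [LHS]mxaddE mxoppE.
have H : nab l (nab k (dform c f)) p 0 j - nab k (nab l (dform c f)) p 0 j =
    - (dform c f p *m curv g c l k p) 0 j.
  transitivity ((nab l (nab k (dform c f)) p - nab k (nab l (dform c f)) p) 0 j).
    by rewrite [RHS]mxaddE mxoppE.
  by rewrite nabla2_comm// mxoppE.
have rowC : row k ((C l p)^T *m hess f p) 0 j = row l ((C k p)^T *m hess f p) 0 j.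
  rewrite !mxE; apply: eq_bigr => m _; congr (_ * _).
  by rewrite ![(_)^T _ _]mxE chr_sym.
have aux (x y r w : R) : x - y = - w -> x - r = y - r - w by move=> ?; lra.
by rewrite !rowE rowC; exact: aux H.
Qed.

Definition energy f p : R := 2^-1 * inner g c p (gradient g f c p) (gradient g f c p).

Lemma pairing_sym (a b : 'rV[R]_n.+1) p : D p ->
  (a *m G p *m b^T) 0 0 = (b *m G p *m a^T) 0 0.
Proof.
move=> Dp; transitivity ((a *m G p *m b^T)^T 0 0); first by rewrite [RHS]mxE.
by rewrite !trmx_mul trmxK ginv_sym// mulmxA.
Qed.

Lemma chart_diff_pairing k (a b : M -> 'rV[R]_n.+1) : mdiff c k a -> mdiff c k b ->
  chart_diff c k (fun q => (a q *m G q *m (b q)^T) 0 0).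
Proof.
move=> da db.
have H : mdiff c k (fun q => a q *m G q *m (b q)^T); last exact: H.
apply: mdiffM; last exact: mdiff_tr.
by apply: mdiffM => //; exact: ginv_diff.
Qed.

Lemma energy_diff k f : chart_diff c k.+1 f -> chart_diff c k (energy f).
Proof.
move=> df; apply: chart_diffM; first exact: chart_diff_cst.
have dw := dform_diff df.
by apply: chart_diff_eq (chart_diff_pairing dw dw) => q Dq; rewrite inner_gradient.
Qed.

Lemma partial_energy f k p : chart_diff c 2 f -> D p ->
  partial c k (energy f) p = (nab k (dform c f) p *m G p *m (dform c f p)^T) 0 0.
Proof.
move=> df Dp; have dw := dform_diff df.
have dp := chart_diff_pairing dw dw.
rewrite (@partial_eq _ _ _ c _ (fun q => 2^-1 * (dform c f q *m G q *m (dform c f q)^T) 0 0))//.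
  rewrite partialM ?partial_cst//; last exact: chart_diff_cst.
  rewrite partial_pairing// mul0r add0r.
  by rewrite [X in _ + X]pairing_sym//; lra.
by move=> q Dq; rewrite /energy inner_gradient.
Qed.

(** Differentiating [partial_energy] again produces an iterated [nabla]; the Christoffel term of the
    Hessian turns it into the covariant derivative [covhess]. *)
Lemma hessian_energy f k l p : chart_diff c 3 f -> D p ->
  hess (energy f) p k l =
  (row l (covhess f k p) *m G p *m (dform c f p)^T) 0 0
  + (hess f p *m G p *m hess f p) l k.
Proof.
move=> df Dp; have df2 := chart_diff_pred df.
have dw := dform_diff df2; have dn := nabla_diff l df.
have E1 : partial c k (partial c l (energy f)) p =
    (nab k (nab l (dform c f)) p *m G p *m (dform c f p)^T) 0 0
    + (hess f p *m G p *m hess f p) l k.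
  rewrite (@partial_eq _ _ _ c _
     (fun q => (nab l (dform c f) q *m G q *m (dform c f q)^T) 0 0))//; last first.
    by move=> q Dq; rewrite partial_energy.
  rewrite partial_pairing// -!hessian_row//; congr (_ + _).
  rewrite -row_mul tr_row hessian_sym// [LHS]mxE [RHS]mxE.
  by apply: eq_bigr => m _; rewrite [row _ _ _ _]mxE [col _ _ _ _]mxE.
have E2 : \sum_m christoffel g c m k l p * partial c m (energy f) p =
    (row l ((C k p)^T *m hess f p) *m G p *m (dform c f p)^T) 0 0.
  rewrite -!row_mul -!mulmxA [RHS]mxE [RHS]mxE; apply: eq_bigr => m _.
  rewrite partial_energy// -hessian_row// -!row_mul [(_)^T _ _]mxE [C _ _ _ _]mxE.
  by rewrite [row _ _ _ _]mxE !mulmxA.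
rewrite [LHS]mxE E1 E2 addrAC; congr (_ + _).
by rewrite covhess_row// 2![in RHS]mulmxBl [RHS]mxaddE mxoppE.
Qed.

(** Trace of [hessian_energy]. Its third-order term becomes the derivative of the Laplacian once two
    indices are exchanged, and the curvature created by the exchange contracts to the Ricci term. *)
Lemma bochner f p : chart_diff c 3 f -> D p ->
  let v := gradient g f c p in
  laplacian g (energy f) c p =
  (dform c (laplacian g f c) p *m v^T) 0 0 + (v *m ricci g c p *m v^T) 0 0
  + \tr (G p *m hess f p *m G p *m hess f p).
Proof.
move=> df Dp /=; set v := gradient g f c p; set H := hess f p.
have vE : v = dform c f p *m G p by rewrite /v gradientE.
have vT : G p *m (dform c f p)^T = v^T by rewrite vE trmx_mul ginv_sym.
have HT : H^T = H by apply: hessian_sym => //; exact: chart_diff_pred.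
have trHH : \sum_l \sum_k G p l k * (H *m G p *m H) l k = \tr (G p *m H *m G p *m H).
  have -> : G p *m H *m G p *m H = G p *m (H *m G p *m H)^T.
    by rewrite !trmx_mul HT ginv_sym// !mulmxA.
  apply: eq_bigr => l _; rewrite [RHS]mxE; apply: eq_bigr => k _.
  by rewrite [(_)^T _ _]mxE.
(* Symmetry of D^2 f first brings j into the position that the Ricci identity exchanges with the
   direction k. *)
have key j : \sum_l \sum_k G p l k * covhess f k p l j =
    \tr (G p *m covhess f j p) - \sum_k (dform c f p *m curv g c k j p *m G p) 0 k.
  transitivity (\sum_l \sum_k (G p l k * covhess f j p k l
      - (dform c f p *m curv g c k j p) 0 l * G p l k)).
    apply: eq_bigr => l _; apply: eq_bigr => k _.
    have -> : covhess f k p l j = covhess f k p j l.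
      by rewrite -[in RHS](covhess_sym k df Dp) [RHS]mxE.
    by rewrite (covhess_comm k j l df Dp) mulrBr [X in _ - X = _]mulrC.
  under eq_bigr do rewrite sumrB.
  rewrite sumrB; congr (_ - _).
    by apply: eq_bigr => l _; rewrite [RHS]mxE.
  by rewrite exchange_big; apply: eq_bigr => k _; rewrite [RHS]mxE.
(* Skewness moves the curvature matrix through the metric, so that the sum over k becomes the trace
   that defines [ricci]. *)
have keyR k j : dform c f p *m curv g c k j p *m G p = - (v *m (curv g c k j p)^T).
  have -> : dform c f p = v *m gc p by rewrite vE -mulmxA ginv_mulmx// mulmx1.
  have /eqP := curv_antisym g k j Dp; rewrite addrC addr_eq0 => /eqP E.
  by rewrite -(mulmxA v) E mulmxN mulNmx -!mulmxA mulmx_ginv// mulmx1.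
transitivity (\sum_l \sum_k (G p l k * (\sum_j covhess f k p l j * v 0 j)
            + G p l k * (H *m G p *m H) l k)).
  rewrite /laplacian /mxtrace; apply: eq_bigr => l _; rewrite mxE.
  apply: eq_bigr => k _; rewrite hessian_energy// -mulrDr; congr (_ * (_ + _)).
  rewrite -mulmxA vT [LHS]mxE; apply: eq_bigr => j _.
  by rewrite [row _ _ _ _]mxE [(_)^T _ _]mxE.
under eq_bigr do rewrite big_split.
rewrite big_split /= trHH; congr (_ + _).
transitivity (\sum_j (\sum_l \sum_k G p l k * covhess f k p l j) * v 0 j).
  under eq_bigr do under eq_bigr do rewrite mulr_sumr.
  under eq_bigr do rewrite exchange_big.
  rewrite exchange_big; apply: eq_bigr => j _ /=.
  rewrite mulr_suml; apply: eq_bigr => l _; rewrite mulr_suml.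
  by apply: eq_bigr => k _; rewrite mulrA.
under eq_bigr do rewrite key mulrBl.
rewrite sumrB; congr (_ + _).
  rewrite [RHS]mxE; apply: eq_bigr => j _.
  by rewrite [dform _ _ _ _ _]mxE [(_)^T _ _]mxE partial_laplacian.
rewrite -sumrN -mulmxA [RHS]mxE; apply: eq_bigr => j _.
rewrite -mulNr -sumrN mulrC; congr (_ * _); rewrite [RHS]mxE.
under eq_bigr do rewrite keyR mxoppE opprK mxE.
rewrite exchange_big; apply: eq_bigr => m _ /=.
rewrite [(_)^T _ _]mxE [ricci _ _ _ _ _]mxE mulr_suml; apply: eq_bigr => k _.
by rewrite [(_)^T _ _]mxE mulrC riemannE.
Qed.

End Bochner.

(** * Positive definite matrices *)

Section LinearAlgebra.
Variable R : realType.

Definition qform n (A : 'M[R]_n) (v : 'rV[R]_n) : R := (v *m A *m v^T) 0 0.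

(** Cholesky factorization, by induction through the Schur complement of the corner entry. It stands
    in for an orthonormal frame. *)
Lemma posdef_factor n (A : 'M[R]_n) : A^T = A ->
  (forall v : 'rV[R]_n, v != 0 -> 0 < qform A v) -> exists B : 'M[R]_n, A = B *m B^T.
Proof.
elim: n A => [|n IH] A AT Apos.
  by exists 0; apply/matrixP => -[].
move: A AT Apos; rewrite -add1n => A AT Apos.
pose a := ulsubmx A; pose r := ursubmx A; pose S := drsubmx A.
have AE : A = block_mx a r r^T S.
  by rewrite -[LHS]submxK; congr block_mx; rewrite -[in LHS]AT -trmx_ursub.
have sT : S^T = S by rewrite trmx_drsub AT.
have aE : a = (a 0 0)%:M := mx11_scalar a.
have a0 : 0 < a 0 0.
  have : 0 < qform A (row_mx (1%:M) 0).
    apply: Apos; apply/eqP => /(congr1 lsubmx); rewrite row_mxKl linear0.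
    by move=> /matrixP/(_ 0 0); rewrite !mxE => /eqP; rewrite oner_eq0.
  rewrite /qform AE mul_row_block tr_row_mx mul_row_col !mul0mx !addr0 !mul1mx.
  by rewrite trmx1 mulmx1 trmx0 mulmx0 addr0.
have a_neq0 : a 0 0 != 0 by rewrite gt_eqF.
set s := Num.sqrt (a 0 0).
have s0 : s != 0 by rewrite gt_eqF// sqrtr_gt0.
have ss : s * s = a 0 0 by rewrite -expr2 sqr_sqrtr// ltW.
pose S' := S - (a 0 0)^-1 *: (r^T *m r).
have [||B' BE] := IH S'.
- by rewrite /S' trmxB sT linearZ /= trmx_mul trmxK.
- move=> v v0.
  (* This completes v so that the cross terms vanish: the form A at x equals the form S' at v. *)
  pose x : 'rV[R]_(1 + n) := row_mx (- (a 0 0)^-1 *: (v *m r^T)) v.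
  have : 0 < qform A x.
    apply: Apos; apply: contra_neq v0 => /(congr1 rsubmx).
    by rewrite row_mxKr linear0.
  rewrite /qform AE mul_row_block tr_row_mx mul_row_col.
  suff -> : (- (a 0 0)^-1 *: (v *m r^T)) *m a + v *m r^T = 0.
    rewrite mul0mx add0r /S' mulmxBr mulmxBl.
    by rewrite mulmxDl scaleNr !mulNmx -!scalemxAr -!scalemxAl !mulmxA addrC.
  have -> (y : 'M[R]_1) : y *m a = a 0 0 *: y by rewrite [in LHS]aE mul_mx_scalar.
  by rewrite scalerA mulrN mulfV// scaleN1r addNr.
exists (block_mx s%:M 0 (s^-1 *: r^T) B').
rewrite tr_block_mx mulmx_block trmx0 !mulmx0 !mul0mx !addr0 tr_scalar_mx.
rewrite -BE linearZ /= trmxK AE /S'; congr block_mx.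
- by rewrite -scalar_mxM ss -aE.
- by rewrite mul_scalar_mx scalerA mulfV// scale1r.
- by rewrite -scalemxAl mul_mx_scalar scalerA mulVf// scale1r.
- by rewrite -scalemxAl -scalemxAr scalerA -invfM ss addrC subrK//.
Qed.

Lemma mxtrace_qform n (B S : 'M[R]_n) :
  \tr (B *m B^T *m S) = \sum_i qform S (row i B^T).
Proof.
rewrite -mulmxA mxtrace_mulC /mxtrace; apply: eq_bigr => i _.
rewrite /qform -row_mul tr_row trmxK.
by rewrite [LHS]mxE [RHS]mxE; apply: eq_bigr => j _; rewrite [row _ _ _ _]mxE [col _ _ _ _]mxE.
Qed.

(** The sum of the squared deviations from the mean m is nonnegative. *)
Lemma sum_sqr_le n (x : 'I_n -> R) : (\sum_i x i) ^+ 2 <= n%:R * \sum_i x i ^+ 2.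
Proof.
case: n x => [|n] x; first by rewrite !big_ord0 expr0n mulr0.
set S := \sum_i x i; pose m := S / n.+1%:R.
have : 0 <= \sum_i (x i - m) ^+ 2 by apply: sumr_ge0 => i _; rewrite sqr_ge0.
have -> : \sum_i (x i - m) ^+ 2 = \sum_i x i ^+ 2 - m * S.
  transitivity (\sum_i (x i ^+ 2 - 2 * m * x i + m ^+ 2)).
    by apply: eq_bigr => i _; ring.
  rewrite big_split sumrB -mulr_sumr sumr_const card_ord -/S /= -mulr_natr /m.
  by field; rewrite nat1r pnatr_eq0.
by rewrite subr_ge0 /m mulrAC -expr2 ler_pdivrMr ?ltr0n// mulrC.
Qed.

(** In the frame given by B the form H has the symmetric matrix X = B^T H B. One trace is the sum of
    its diagonal entries, the other the sum of the squares of all its entries. *)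
Lemma trace_sqr_le n (G H : 'M[R]_n) : G^T = G ->
  (forall v : 'rV[R]_n, v != 0 -> 0 < qform G v) -> H^T = H ->
  (\tr (G *m H)) ^+ 2 <= n%:R * \tr (G *m H *m G *m H).
Proof.
move=> GT Gpos HT; have [B ->] := posdef_factor GT Gpos.
pose X := B^T *m H *m B.
have XT : X^T = X by rewrite /X !trmx_mul HT trmxK mulmxA.
have -> : \tr (B *m B^T *m H) = \sum_i X i i.
  by rewrite -mulmxA mxtrace_mulC.
have -> : \tr (B *m B^T *m H *m (B *m B^T) *m H) = \sum_i \sum_j X i j ^+ 2.
  transitivity (\tr (X *m X)).
    by rewrite /X -!mulmxA mxtrace_mulC !mulmxA.
  apply: eq_bigr => i _; rewrite [LHS]mxE; apply: eq_bigr => j _.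
  by rewrite -{2}XT [X^T _ _]mxE expr2.
apply: (le_trans (sum_sqr_le _)); rewrite ler_wpM2l//.
apply: ler_sum => i _; rewrite (bigD1 i)//= lerDl.
by apply: sumr_ge0 => j _; rewrite sqr_ge0.
Qed.

Lemma trace_le0 n (G H : 'M[R]_n) : G^T = G ->
  (forall v : 'rV[R]_n, v != 0 -> 0 < qform G v) ->
  (forall v : 'rV[R]_n, qform H v <= 0) -> \tr (G *m H) <= 0.
Proof.
move=> GT Gpos Hneg; have [B ->] := posdef_factor GT Gpos.
by rewrite mxtrace_qform; apply: sumr_le0.
Qed.

Lemma cauchy_schwarz n (G : 'M[R]_n) (a b : 'rV[R]_n) : G^T = G ->
  (forall v : 'rV[R]_n, v != 0 -> 0 < qform G v) ->
  ((a *m G *m b^T) 0 0) ^+ 2 <= qform G a * qform G b.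
Proof.
move=> GT Gpos.
have Gge0 v : 0 <= qform G v.
  have [->|/Gpos/ltW//] := eqVneq v 0.
  by rewrite /qform !mul0mx mxE.
have [b0|b0] := eqVneq b 0.
  by rewrite b0 trmx0 mulmx0 mxE expr0n mulr_ge0.
have bb := Gpos _ b0.
set x := (a *m G *m b^T) 0 0.
have xE : (b *m G *m a^T) 0 0 = x.
  transitivity ((b *m G *m a^T)^T 0 0); first by rewrite [RHS]mxE.
  by rewrite !trmx_mul trmxK GT mulmxA.
pose t := x / qform G b.
have := Gge0 (a - t *: b).
have -> : qform G (a - t *: b) = qform G a - t * x - t * x + t * t * qform G b.
  rewrite /qform trmxB [(t *: b)^T]linearZ /= !(mulmxBl, mulmxBr) -!scalemxAr -!scalemxAl.
  rewrite !mxDE !mxscaleE.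
  rewrite -/x xE; ring.
have -> : t * t * qform G b = t * x by rewrite /t -mulrA divfK ?gt_eqF// mulrC.
by rewrite subrK subr_ge0 /t mulrAC ler_pdivrMr// expr2.
Qed.
End LinearAlgebra.

(** * The maximum principle in a chart *)

Section MaximumPrinciple.
Variables (R : realType) (n : nat) (M : bmanifold R n) (g : riem_metric M).
Variable c : charts M.
Implicit Types (f h u : M -> R) (p q : M).
Local Notation V := 'rV[R]_n.+1.
Local Notation G := (ginv g c).
Local Notation gc := (gmat g c).
Local Notation D := (cdom c).
Local Notation hess f := (hessian g f c).

Lemma derive_coord (F : V -> R) x v : differentiable F x ->
  'D_v F x = \sum_i v 0 i * 'D_(basis_vec R i) F x.
Proof.
move=> dF; rewrite (deriveE v dF) {1}(row_sum_delta v) linear_sum.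
by apply: eq_bigr => i _; rewrite linearZ (deriveE _ dF).
Qed.

Lemma first_derive_max_ray (F : V -> R) x v (r : R) : 0 < r -> differentiable F x ->
  (forall t, 0 <= t <= r -> F (x + t *: v) <= F x) -> 'D_v F x <= 0.
Proof.
move=> r0 dF Fmax; rewrite leNgt; apply/negP => c0.
set d := 'D_v F x in c0.
pose e := d / 2 / (`|v| + 1).
have v0 : 0 < `|v| + 1 by rewrite ltr_wpDl.
have e0 : 0 < e by rewrite !divr_gt0.
have [r2 r20 H2] := near_line v (diff_expansion dF e0).
pose t := Num.min r r2.
have t0 : 0 < t by rewrite lt_min r0 r20.
have tr : t <= r by rewrite ge_min lexx.
have tr2 : t <= r2 by rewrite ge_min lexx orbT.
have := Fmax t; rewrite tr (ltW t0) => /(_ isT); rewrite leNgt => /negP; apply.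
rewrite -subr_gt0.
have /(_ _) := H2 t; rewrite ger0_norm ?(ltW t0)// => /(_ tr2).
rewrite add0r linearZ /= -(deriveE v dF) -/d normrZ (gtr0_norm t0).
move=> /ler_normlP[]; rewrite opprB => H _; move: H; rewrite lerBlDr -lerBlDl.
apply: lt_le_trans; rewrite subr_gt0 mulrCA ltr_pM2l//.
rewrite /e mulrAC ltr_pdivrMr//; have := normr_ge0 v; nra.
Qed.

(* The half-line from [p] in the direction [v] starts inside the half-space. *)
Definition admissible p (v : V) : Prop := 0 < cmap c p 0 ord0 \/ 0 <= v 0 ord0.

Lemma max_ray f p v (Z : set V) (F : V -> R) : D p -> open Z -> Z (cmap c p) ->
  (forall q, D q -> Z (cmap c q) -> F (cmap c q) = f q) ->
  (forall q, D q -> f q <= f p) -> admissible p v ->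
  exists2 r : R, 0 < r & forall t, 0 <= t <= r -> F (cmap c p + t *: v) <= F (cmap c p).
Proof.
move=> Dp oZ Zp FE fmax pv.
have [r r0 Hr] := near_ray_img Dp pv.
have [r' r'0 Hr'] := near_line v (open_nbhs_nbhs (conj oZ Zp)).
exists (Num.min r r'); first by rewrite lt_min r0.
move=> t /andP[t0]; rewrite le_min => /andP[tr tr'].
have [|Dq qE] := @cinv_img _ _ _ c (cmap c p + t *: v); first by apply: Hr; rewrite t0.
rewrite -qE !FE//; first exact: fmax.
by rewrite qE; apply: Hr'; rewrite ger0_norm.
Qed.

Lemma max_direction f p v : chart_diff c 1 f -> D p -> (forall q, D q -> f q <= f p) ->
  admissible p v -> (dform c f p *m v^T) 0 0 <= 0.
Proof.
move=> df Dp fmax pv; have [Z [F [oZ Zp [dF _] FE]]] := df p Dp.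
have [r r0 Hr] := max_ray Dp oZ Zp FE fmax pv.
apply: le_trans (first_derive_max_ray r0 (dF _ Zp) Hr).
rewrite (derive_coord _ (dF _ Zp)) [leLHS]mxE.
apply: ler_sum => i _; rewrite [dform _ _ _ _ _]mxE [_^T _ _]mxE mulrC.
by rewrite (partialE i Dp oZ Zp (dF _ Zp) FE).
Qed.

(** At a critical point the Christoffel terms of the Hessian vanish, and the form at v is the second
    derivative of a local extension along v. *)
Lemma max_hessian f p v : chart_diff c 2 f -> D p -> (forall q, D q -> f q <= f p) ->
  dform c f p = 0 -> qform (hess f p) v <= 0.
Proof.
move=> df Dp fmax f0.
(* Of v and -v, at least one does not point outward. *)
wlog v0 : v / 0 <= v 0 ord0 => [H|].
  have [v0|/ltW v0] := leP 0 (v 0 ord0); first exact: H.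
  have := H (- v); rewrite mxoppE oppr_ge0 => /(_ v0).
  by rewrite /qform trmxN mulmxN !mulNmx opprK.
have pv : admissible p v by right.
have [Z [F [oZ Zp [dF dDF] FE]]] := df p Dp.
have [r r0 Hr] := max_ray Dp oZ Zp FE fmax pv.
have HE i q : D q -> Z (cmap c q) -> 'D_(basis_vec R i) F (cmap c q) = partial c i f q.
  by move=> Dq Zq; rewrite (partialE _ Dq oZ Zq (dF _ Zq) FE).
have part0 i : partial c i f p = 0.
  by have := congr1 (fun w : 'rV[R]_n.+1 => w 0 i) f0; rewrite [X in X = _]mxE [X in _ = X]mxE.
(* [diffn] only speaks of coordinate derivatives; near the point ['D_v F] is this combination of
   them. *)
pose S := \sum_(i < n.+1) (v 0 i *: ('D_(basis_vec R i) F)).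
have ddF i : differentiable ('D_(basis_vec R i) F) (cmap c p) by exact: (dDF i).1.
have dvZ i : differentiable (v 0 i *: 'D_(basis_vec R i) F) (cmap c p).
  exact: differentiableZ.
have dS : differentiable S (cmap c p).
  rewrite /S; exact: differentiable_sum.
have nZ := open_nbhs_nbhs (conj oZ Zp).
have DvE : \forall y \near cmap c p, S y = 'D_v F y.
  apply: filterS nZ => y Zy; rewrite (derive_coord _ (dF _ Zy)) /S fct_sumE.
  by [].
have dDv := near_eq_differentiable DvE dS.
have ndF : \forall y \near cmap c p, differentiable F y by exact: filterS nZ.
have Dv0 : 'D_v F (cmap c p) = 0.
  rewrite (derive_coord _ (dF _ Zp)) big1// => i _.
  by rewrite HE// part0 mulr0.
apply: le_trans (second_derive_max_ray r0 ndF dDv Dv0 _); last first.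
  by move=> t /andP[t0 tr]; apply: Hr; rewrite !ltW.
rewrite -(near_eq_derive v DvE) /S derive_sum; last by move=> i; exact: diff_derivable.
rewrite /qform -mulmxA [leLHS]mxE; apply: ler_sum => i _.
rewrite deriveZ; last exact: diff_derivable.
rewrite [X in _ <= X](_ : _ = v 0 i * 'D_v ('D_(basis_vec R i) F) (cmap c p))//.
rewrite (derive_coord _ (ddF i)) le_eqVlt; apply/orP; left; apply/eqP; congr (_ * _).
rewrite [LHS]mxE; apply: eq_bigr => j _; rewrite [_^T _ _]mxE mulrC; congr (_ * _).
rewrite [LHS]mxE big1 ?subr0; last by move=> k _; rewrite part0 mulr0.
by rewrite partial_comm// (partialE j Dp oZ Zp (ddF i) (HE i)).
Qed.

Lemma ginv_posdef p v : D p -> v != 0 -> 0 < qform (G p) v.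
Proof.
move=> Dp v0.
have -> : qform (G p) v = ((v *m G p) *m gc p *m (v *m G p)^T) 0 0.
  by rewrite trmx_mul ginv_sym// -(mulmxA v) ginv_mulmx// mulmx1 mulmxA.
apply: gmat_pos => //; apply: contra_neq v0 => /(congr1 (mulmx^~ (gc p))).
by rewrite -mulmxA ginv_mulmx// mulmx1 mul0mx.
Qed.

Lemma drift_laplacian_max h f p : chart_diff c 2 f -> D p ->
  (forall q, D q -> f q <= f p) -> dform c f p = 0 -> drift_laplacian g h f c p <= 0.
Proof.
move=> df Dp fmax f0; rewrite /drift_laplacian inner_gradient// f0 trmx0 mulmx0 mxE subr0.
apply: trace_le0; first exact: ginv_sym.
- by move=> v; exact: ginv_posdef.
- by move=> v; exact: max_hessian.
Qed.

Lemma drift_laplacianE h f p : D p -> drift_laplacian g h f c p =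
  \tr (G p *m hess f p) - (dform c h p *m G p *m (dform c f p)^T) 0 0.
Proof. by move=> Dp; rewrite /drift_laplacian inner_gradient. Qed.

Lemma dformD f f' p : chart_diff c 1 f -> chart_diff c 1 f' -> D p ->
  dform c (fun q => f q + f' q) p = dform c f p + dform c f' p.
Proof.
by move=> df df' Dp; apply/rowP => i; rewrite mxaddE ![dform _ _ _ _ _]mxE partialD.
Qed.

Lemma dformM f f' p : chart_diff c 1 f -> chart_diff c 1 f' -> D p ->
  dform c (fun q => f q * f' q) p = f' p *: dform c f p + f p *: dform c f' p.
Proof.
move=> df df' Dp; apply/rowP => i; rewrite mxaddE !mxscaleE ![dform _ _ _ _ _]mxE partialM//.
by rewrite mulrC.
Qed.

Lemma hessianE f i j p : hess f p i j =
  partial c i (partial c j f) p - \sum_k christoffel g c k i j p * partial c k f p.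
Proof. exact: mxE. Qed.

Lemma hessianD f f' p : chart_diff c 2 f -> chart_diff c 2 f' -> D p ->
  hess (fun q => f q + f' q) p = hess f p + hess f' p.
Proof.
move=> df df' Dp; have df1 := chart_diff_pred df; have df1' := chart_diff_pred df'.
apply/matrixP => i j; rewrite mxaddE !hessianE.
rewrite (@partial_eq _ _ _ c _ (fun q => partial c j f q + partial c j f' q))//; last first.
  by move=> q Dq; rewrite partialD.
rewrite partialD//; [|exact: chart_diff_partial..].
under eq_bigr do rewrite partialD// mulrDr.
by rewrite big_split opprD /= !addrA; congr (_ - _); rewrite addrAC.
Qed.

Lemma hessian_halfsq (b : R) f p : chart_diff c 2 f -> D p ->
  hess (fun q => b * (f q * f q)) p =
    (2 * b) *: ((dform c f p)^T *m dform c f p + f p *: hess f p).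
Proof.
move=> df Dp; have df1 := chart_diff_pred df.
have pE k q : D q -> partial c k (fun q => b * (f q * f q)) q = 2 * b * (f q * partial c k f q).
  move=> Dq; rewrite partialM ?partial_cst ?partialM//; [ring|exact: chart_diff_cst|].
  exact: chart_diffM.
apply/matrixP => i j; rewrite mxscaleE mxaddE mxscaleE !hessianE.
rewrite (partial_eq i Dp (pE j)) partialM ?partial_cst//; [|exact: chart_diff_cst|]; last first.
  by apply: chart_diffM => //; exact: chart_diff_partial.
rewrite partialM//; last exact: chart_diff_partial.
rewrite [X in _ - X](_ : _ = 2 * b * f p * \sum_k christoffel g c k i j p * partial c k f p).
  rewrite [(_ *m _) i j]mxE big_ord1 [_^T _ _]mxE ![dform _ _ _ _ _]mxE.
  ring.
by rewrite mulr_sumr; apply: eq_bigr => k _; rewrite pE//; ring.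
Qed.
End MaximumPrinciple.

(* With [U = u], [x = <Dh, Du>], [P = |Dh|^2], [Q = |Du|^2], [T = |D^2 u|^2] and
   [S = (Ric + D^2 h) (Du, Du)]. *)
Lemma barrier_scalar_ineq (R : realType) (m z A lam b U x P Q T S : R) :
  0 < m -> 0 < z -> (- (lam * U) + x) ^+ 2 <= m * T -> x ^+ 2 <= P * Q ->
  (P / (m * z) + A) * Q <= S ->
  (lam ^+ 2 / (m * (z + 1)) - b * lam) * U ^+ 2 + (A - lam + b) * Q <=
  T + S - lam * Q + b * (Q - lam * U ^+ 2).
Proof.
move=> m0 z0 HT Hx HS.
have z10 : 0 < z + 1 by rewrite addr_gt0.
have mz0 : 0 < m * z by rewrite mulr_gt0.
have H1 : (lam * U) ^+ 2 / (z + 1) - x ^+ 2 / z <= (- (lam * U) + x) ^+ 2.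
  rewrite -subr_ge0.
  have -> : (- (lam * U) + x) ^+ 2 - ((lam * U) ^+ 2 / (z + 1) - x ^+ 2 / z) =
      (- (z * (lam * U)) + (z + 1) * x) ^+ 2 / (z * (z + 1)).
    by field; rewrite !gt_eqF.
  by rewrite divr_ge0 ?sqr_ge0// mulr_ge0// ltW.
have H2 : ((lam * U) ^+ 2 / (z + 1) - x ^+ 2 / z) / m <= T.
  by rewrite ler_pdivrMr// (mulrC T); exact: le_trans H1 HT.
have H3 : x ^+ 2 / (m * z) <= P * Q / (m * z) by rewrite ler_pM2r// invr_gt0.
have E1 : ((lam * U) ^+ 2 / (z + 1) - x ^+ 2 / z) / m =
   lam ^+ 2 / (m * (z + 1)) * U ^+ 2 - x ^+ 2 / (m * z).
  by field; rewrite !gt_eqF.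
have E2 : (P / (m * z) + A) * Q = P * Q / (m * z) + A * Q.
  by field; rewrite !gt_eqF.
rewrite E1 in H2; rewrite E2 in HS.
move: H2 HS H3; clear; move: (x ^+ 2 / _) (P * Q / _) (lam ^+ 2 / _) => X Y K H2 HS H3.
nra.
Qed.

(** * Bochner formula for the drifting Laplacian of an eigenfunction *)

Section DriftBochner.
Variables (R : realType) (n : nat) (M : bmanifold R n) (g : riem_metric M).
Variables (c : charts M) (h u : M -> R) (lam : R).
Implicit Types (p q : M).
Local Notation V := 'rV[R]_n.+1.
Local Notation G := (ginv g c).
Local Notation gc := (gmat g c).
Local Notation D := (cdom c).
Local Notation hess f := (hessian g f c).
Local Notation grad f := (gradient g f c).
Hypothesis hD : chart_diff c 3 h.
Hypothesis uD : chart_diff c 4 u.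
Hypothesis eigen : forall q, D q -> - drift_laplacian g h u c q = lam * u q.

Lemma gradient_tr f p : D p -> (grad f p)^T = G p *m (dform c f p)^T.
Proof. by move=> Dp; rewrite gradientE// trmx_mul ginv_sym. Qed.

Lemma laplacian_eigen q : D q -> laplacian g u c q =
  (dform c h q *m G q *m (dform c u q)^T) 0 0 - lam * u q.
Proof.
move=> Dq; rewrite -eigen// /drift_laplacian inner_gradient// opprK.
by rewrite addrCA subrr addr0.
Qed.

(** The derivative of [laplacian_eigen]. In the Bochner formula the term in [hess h] joins the Ricci
    curvature, and the term in [hess u] cancels against the drift of the energy. *)
Lemma dform_laplacian p : D p -> dform c (laplacian g u c) p =
  grad u p *m hess h p + grad h p *m hess u p - lam *: dform c u p.
Proof.
move=> Dp; have uD3 := chart_diff_pred uD; have uD2 := chart_diff_pred uD3.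
have hD2 := chart_diff_pred hD.
have dw := dform_diff uD2; have dh := dform_diff hD2.
apply/rowP => j; rewrite mxaddE mxaddE mxoppE mxscaleE ![dform _ _ _ _ _]mxE.
rewrite (@partial_eq _ _ _ c _ (fun q =>
  (dform c h q *m G q *m (dform c u q)^T) 0 0 + (- lam) * u q))//; last first.
  by move=> q Dq; rewrite laplacian_eigen// mulNr.
rewrite partialD//; last 2 first.
- exact: chart_diff_pairing.
- by apply: chart_diffM; [exact: chart_diff_cst|do 3 apply: chart_diff_pred].
rewrite partialM//; last 2 first.
- exact: chart_diff_cst.
- by do 3 apply: chart_diff_pred.
rewrite partial_cst// mul0r add0r mulNr; congr (_ - _).
rewrite partial_pairing// -!hessian_row//; congr (_ + _).
  rewrite -mulmxA -gradient_tr// -{2}(hessian_sym g hD2 Dp).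
  rewrite -row_mul [LHS]mxE.
  transitivity ((hess h p *m (grad u p)^T)^T 0 j); first by rewrite [RHS]mxE.
  by rewrite trmx_mul trmxK.
rewrite -gradientE// -{2}(hessian_sym g uD2 Dp) tr_row [LHS]mxE [RHS]mxE.
by apply: eq_bigr => k _; rewrite [col _ _ _ _]mxE.
Qed.

Lemma dform_energy p : D p -> dform c (energy g c u) p = grad u p *m hess u p.
Proof.
move=> Dp; have uD3 := chart_diff_pred uD; have uD2 := chart_diff_pred uD3.
apply/rowP => j; rewrite [LHS]mxE partial_energy// -hessian_row// -mulmxA.
rewrite -gradient_tr// -row_mul [LHS]mxE.
transitivity ((hess u p *m (grad u p)^T)^T 0 j); first by rewrite [RHS]mxE.
by rewrite trmx_mul trmxK hessian_sym.
Qed.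

Lemma drift_bochner p : D p ->
  drift_laplacian g h (energy g c u) c p =
  \tr (G p *m hess u p *m G p *m hess u p)
  + qform (ricci g c p + hess h p) (grad u p)
  - lam * (dform c u p *m G p *m (dform c u p)^T) 0 0.
Proof.
move=> Dp; have uD3 := chart_diff_pred uD; have uD2 := chart_diff_pred uD3.
rewrite /drift_laplacian bochner// inner_gradient// dform_laplacian// dform_energy//.
rewrite -gradientE// trmx_mul hessian_sym// /qform.
rewrite !(mulmxDl, mulmxDr, mulNmx) -scalemxAl !mulmxA.
have -> : dform c u p *m (grad u p)^T = dform c u p *m G p *m (dform c u p)^T.
  by rewrite gradient_tr// mulmxA.
rewrite 3!mxaddE mxoppE mxscaleE.
have aux (a b x r t : R) : a + b - x + r + t - b = t + (r + a) - x by ring.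
exact: aux.
Qed.

Lemma drift_halfsq (b : R) p : D p ->
  drift_laplacian g h (fun q => b / 2 * (u q * u q)) c p =
  b * ((dform c u p *m G p *m (dform c u p)^T) 0 0 - lam * u p ^+ 2).
Proof.
move=> Dp; have uD3 := chart_diff_pred uD; have uD2 := chart_diff_pred uD3.
have uD1 := chart_diff_pred uD2.
rewrite drift_laplacianE// hessian_halfsq//.
have -> : 2 * (b / 2) = b by field.
rewrite dformM//; [|exact: chart_diff_cst|exact: chart_diffM].
have -> : dform c (fun=> b / 2) p = 0.
  by apply/rowP => i; rewrite [LHS]mxE partial_cst// [RHS]mxE.
rewrite scaler0 add0r dformM// -scalerDl.
rewrite -scalemxAr mxtraceZ mulmxDr mxtraceD -scalemxAr mxtraceZ.
have -> : \tr (G p *m ((dform c u p)^T *m dform c u p)) =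
    (dform c u p *m G p *m (dform c u p)^T) 0 0.
  by rewrite mulmxA mxtrace_mulC mulmxA /mxtrace big_ord1.
have L : \tr (G p *m hess u p) = _ := laplacian_eigen Dp.
rewrite L scalerA [(_ *: _)^T]linearZ /= -scalemxAr mxscaleE.
have aux (q x y : R) : b * (q + y * (x - lam * y)) - b / 2 * (y + y) * x = b * (q - lam * y ^+ 2).
  by field.
exact: aux.
Qed.

(** The function F of the overview; its dependence on the chart is only apparent. *)
Definition barrier (b : R) q : R := energy g c u q + b / 2 * (u q * u q).

Lemma barrier_diff b k : chart_diff c k.+1 u -> chart_diff c k (barrier b).
Proof.
move=> du; have du' := chart_diff_pred du.
apply: chart_diffD; first exact: energy_diff.
by apply: chart_diffM; [exact: chart_diff_cst|exact: chart_diffM].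
Qed.

Lemma drift_barrier_ge (A z b : R) p : D p -> 0 < z ->
  psd (ricci g c p + hess h p
       - (inner g c p (grad h p) (grad h p) / (n.+1%:R * z) + A) *: gc p) ->
  (lam ^+ 2 / (n.+1%:R * (z + 1)) - b * lam) * u p ^+ 2
  + (A - lam + b) * inner g c p (grad u p) (grad u p)
  <= drift_laplacian g h (barrier b) c p.
Proof.
move=> Dp z0 Hpsd; have uD3 := chart_diff_pred uD; have uD2 := chart_diff_pred uD3.
have uD1 := chart_diff_pred uD2.
set P := inner g c p (grad h p) (grad h p) in Hpsd *.
set Q := inner g c p (grad u p) (grad u p).
have QE : (dform c u p *m G p *m (dform c u p)^T) 0 0 = Q by rewrite -inner_gradient.
pose x := (dform c h p *m G p *m (dform c u p)^T) 0 0.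
have GT := ginv_sym g Dp.
have Gpos v : v != 0 -> 0 < qform (G p) v by exact: ginv_posdef.
have dE : chart_diff c 2 (energy g c u) by exact: energy_diff.
have dS : chart_diff c 2 (fun q => b / 2 * (u q * u q)).
  by apply: chart_diffM; [exact: chart_diff_cst|exact: chart_diffM].
have -> : drift_laplacian g h (barrier b) c p =
    drift_laplacian g h (energy g c u) c p +
    drift_laplacian g h (fun q => b / 2 * (u q * u q)) c p.
  rewrite !drift_laplacianE// hessianD// dformD//; last 2 first.
  - exact: chart_diff_pred.
  - exact: chart_diff_pred.
  rewrite trmxD !mulmxDr mxtraceD mxaddE.
  have aux (s t k l : R) : s + t - (k + l) = s - k + (t - l) by ring.
  exact: aux.
rewrite drift_bochner// drift_halfsq// QE.
apply: (@barrier_scalar_ineq _ _ _ _ _ _ _ x P).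
- by rewrite ltr0n.
- exact: z0.
- have -> : - (lam * u p) + x = \tr (G p *m hess u p).
    by rewrite addrC -laplacian_eigen.
  by apply: trace_sqr_le => //; exact: hessian_sym.
- have -> : P = qform (G p) (dform c h p) by rewrite /P inner_gradient.
  by rewrite -QE; exact: cauchy_schwarz.
- have := Hpsd (grad u p); rewrite mulmxBr mulmxBl mxaddE mxoppE subr_ge0.
  by rewrite -scalemxAr -scalemxAl mxscaleE.
Qed.
End DriftBochner.

(** * The boundary *)

Section Boundary.
Variables (R : realType) (n : nat) (M : bmanifold R n) (g : riem_metric M).
Variable nu : charts M -> M -> 'rV[R]_n.+1.
Hypothesis nuP : outward_unit_normal g nu.
Variables (c : charts M).
Implicit Types (p q : M) (f u h : M -> R) (X Y : 'rV[R]_n.+1).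
Local Notation G := (ginv g c).
Local Notation gc := (gmat g c).
Local Notation D := (cdom c).
Local Notation hess f := (hessian g f c).
Local Notation grad f := (gradient g f c).
Local Notation bnd := (boundary_pt c).

Lemma mulmx_basis a (A : 'M[R]_(a, n.+1)) j i :
  (A *m (basis_vec R j)^T) i 0 = A i j.
Proof. by rewrite /basis_vec trmx_delta -colE mxE. Qed.

Lemma basis_mulmx b (A : 'M[R]_(n.+1, b)) i j : (basis_vec R i *m A) 0 j = A i j.
Proof. by rewrite /basis_vec -rowE mxE. Qed.

Lemma ginv00_gt0 q : D q -> 0 < G q ord0 ord0.
Proof.
move=> Dq; have := @ginv_posdef _ _ _ g c q (basis_vec R ord0) Dq.
rewrite /qform mulmx_basis basis_mulmx; apply.
by apply/eqP => /matrixP/(_ 0 ord0); rewrite !mxE eqxx => /eqP; rewrite oner_eq0.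
Qed.

(* The factor [s] such that [nu = s * grad x_0] along the boundary. *)
Definition conormal q : R := - (Num.sqrt (G q ord0 ord0))^-1.

Lemma conormal_diff k : chart_diff c k conormal.
Proof.
apply: chart_diff_pred.
apply: (@chart_diff_eq _ _ _ _ _ (fun q => -1 * (Num.sqrt (G q ord0 ord0))^-1)).
  by move=> q _; rewrite mulN1r.
apply: chart_diffM; first exact: chart_diff_cst.
apply: chart_diffV => [q Dq|]; first by rewrite gt_eqF// sqrtr_gt0 ginv00_gt0.
by apply: chart_diff_sqrt => [q Dq|]; [exact: ginv00_gt0|exact: ginv_diff].
Qed.

Lemma conormal_lt0 q : D q -> conormal q < 0.
Proof. by move=> Dq; rewrite oppr_lt0 invr_gt0 sqrtr_gt0 ginv00_gt0. Qed.

Lemma conormal_sqr q : D q -> conormal q ^+ 2 * G q ord0 ord0 = 1.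
Proof.
move=> Dq; have G0 := ginv00_gt0 Dq.
rewrite sqrrN exprVn sqr_sqrtr ?ltW// mulVf// gt_eqF//.
Qed.

(** Orthogonality to e_1, ..., e_n makes the covector dual to [nu] a multiple of dx_0; the length
    and the sign fix the factor. Along the boundary [nu] is thus the restriction of a field
    differentiable on the whole chart. *)
Lemma normalE q : bnd q -> nu c q = conormal q *: row ord0 (G q).
Proof.
move=> bq; have Dq := bq.1; have [nu1 nuT nu0] := nuP bq.
have [s Es] : exists s, nu c q *m gc q = s *: basis_vec R ord0.
  exists ((nu c q *m gc q) 0 ord0); apply/rowP => j.
  rewrite [RHS]mxE [basis_vec _ _ _ _]mxE eqxx /=.
  have [->|j0] := eqVneq j ord0; first by rewrite mulr1.
  rewrite mulr0; have := nuT (basis_vec R j).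
  rewrite /inner mulmx_basis; apply.
  by rewrite /boundary_tangent mxE (eq_sym ord0) (negbTE j0) andbF.
have nE : nu c q = s *: row ord0 (G q).
  by rewrite rowE scalemxAl -/(basis_vec R ord0) -Es -mulmxA mulmx_ginv// mulmx1.
have nu00 : nu c q 0 ord0 = s * G q ord0 ord0 by rewrite nE mxscaleE [row _ _ _ _]mxE.
have s0 : s < 0.
  by move: nu0; rewrite nu00 pmulr_llt0 ?ginv00_gt0.
have s2 : s ^+ 2 * G q ord0 ord0 = 1.
  move: nu1; rewrite /inner Es -scalemxAl mxscaleE.
  by rewrite /basis_vec -rowE [row _ _ _ _]mxE [_^T _ _]mxE nu00 mulrA.
rewrite nE; congr (_ *: _); apply: oppr_inj.
apply: (@pexpIrn _ 2) => //.
- by rewrite nnegrE oppr_ge0 ltW.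
- by rewrite nnegrE oppr_ge0 ltW// conormal_lt0.
- rewrite [LHS]sqrrN [RHS]sqrrN; apply: (mulIf (lt0r_neq0 (ginv00_gt0 Dq))).
  by rewrite s2 conormal_sqr.
Qed.

Lemma mulmx_normal q (a : 'rV[R]_n.+1) : bnd q ->
  (a *m (nu c q)^T) 0 0 = conormal q * (a *m G q) 0 ord0.
Proof.
move=> bq; rewrite normalE// [(_ *: _)^T]linearZ /= -scalemxAr mxscaleE tr_row.
rewrite ginv_sym; last exact: bq.1.
by rewrite colE mulmxA -colE mxE.
Qed.

(** When [conormal *: row ord0 G] is differentiated, one of the two terms of [ginv_compat] cancels
    the Christoffel term of [covariant], and the derivative of [conormal] multiplies a normal
    vector, orthogonal to Y. Only the symbols Gamma^0_ij remain. *)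
Lemma second_formE p X Y : bnd p -> boundary_tangent X -> boundary_tangent Y ->
  second_form g nu c p X Y = - conormal p * \sum_i X 0 i * (chr g c i p *m Y^T) ord0 0.
Proof.
move=> bp X0 Y0; have Dp := bp.1.
have covE i : i != ord0 -> \row_k (partial c i (fun q => nu c q 0 k) p
     + \sum_j christoffel g c k i j p * nu c p 0 j) =
   partial c i conormal p *: row ord0 (G p) - conormal p *: row ord0 (chr g c i p *m G p).
  move=> i0.
  have -> : \row_k (partial c i (fun q => nu c q 0 k) p
     + \sum_j christoffel g c k i j p * nu c p 0 j) =
     mpart c i (fun q => conormal q *: row ord0 (G q)) p
     + conormal p *: row ord0 (G p) *m (chr g c i p)^T.
    apply/rowP => k; rewrite [LHS]mxE mxaddE; congr (_ + _).
      rewrite [RHS]mxE; apply: partial_eq_boundary => // q bq.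
      by rewrite normalE.
    rewrite [RHS]mxE; apply: eq_bigr => j _; rewrite -normalE// mulrC; congr (_ * _).
    by rewrite [_^T _ _]mxE [chr _ _ _ _ _ _]mxE.
  have dG : mdiff c 1 (fun q => row ord0 (G q)).
    move=> a b; apply: (@chart_diff_eq _ _ _ _ _ (fun q => G q ord0 b)) => [q _|].
      by rewrite mxE.
    exact: ginv_diff.
  rewrite mpartZ//; last exact: conormal_diff.
  have -> : mpart c i (fun q => row ord0 (G q)) p = row ord0 (mpart c i G p).
    apply/rowP => k; rewrite [LHS]mxE [RHS]mxE [RHS]mxE.
    by apply: partial_eq => // q _; rewrite mxE.
  rewrite ginv_compat// raddfB /= raddfN /= scalerBr scalerN -scalemxAl -row_mul.
  by rewrite -addrA subrK.
have -> : second_form g nu c p X Y = \sum_i X 0 i *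
    ((\row_k (partial c i (fun q => nu c q 0 k) p
     + \sum_j christoffel g c k i j p * nu c p 0 j)) *m gc p *m Y^T) 0 0.
  rewrite /second_form /inner.
  have -> : covariant g nu c p X = \sum_i X 0 i *:
     (\row_k (partial c i (fun q => nu c q 0 k) p
     + \sum_j christoffel g c k i j p * nu c p 0 j)).
    apply/rowP => k; rewrite [LHS]mxE summxE; apply: eq_bigr => i _.
    by rewrite mxscaleE [(\row__ _) _ _]mxE.
  rewrite !mulmx_suml summxE; apply: eq_bigr => i _.
  by rewrite -!scalemxAl mxscaleE.
rewrite mulr_sumr; apply: eq_bigr => i _.
have [->|i0] := eqVneq i ord0; first by rewrite X0 !mul0r mulr0.
rewrite mulrCA; congr (_ * _); rewrite covE//.
have -> : (partial c i conormal p *: row ord0 (G p)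
    - conormal p *: row ord0 (chr g c i p *m G p)) *m gc p =
  partial c i conormal p *: basis_vec R ord0 - conormal p *: row ord0 (chr g c i p).
  by rewrite mulmxBl -!scalemxAl -!row_mul -mulmxA ginv_mulmx// mulmx1 row1.
rewrite mulmxBl -!scalemxAl mxaddE mxoppE !mxscaleE basis_mulmx [_^T _ _]mxE Y0.
by rewrite mulr0 add0r -row_mul [RHS]mulNr [row _ _ _ _]mxE.
Qed.

Lemma normal_derivE f q : bnd q ->
  normal_deriv g nu f c q = conormal q * grad f q 0 ord0.
Proof.
move=> bq; have Dq := bq.1; rewrite /normal_deriv /inner mulmx_normal//.
by rewrite -mulmxA mulmx_ginv// mulmx1.
Qed.

(** The Neumann condition says that Du has no e_0 component along the boundary; it is differentiated
    in the tangential direction Du. The left-hand side is the normal derivative of |Du|^2 / 2. *)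
Lemma neumann_energy u p : chart_diff c 3 u -> bnd p ->
  (forall q, bnd q -> normal_deriv g nu u c q = 0) ->
  boundary_tangent (grad u p) /\
  ((grad u p *m hess u p) *m (nu c p)^T) 0 0 = - second_form g nu c p (grad u p) (grad u p).
Proof.
move=> du bp Hn; have Dp := bp.1.
have du2 := chart_diff_pred du; have dw := dform_diff du2.
have v0 q : bnd q -> (dform c u q *m G q) 0 ord0 = 0.
  move=> bq; have := Hn q bq; rewrite normal_derivE// gradientE; last exact: bq.1.
  by move/eqP; rewrite mulf_eq0 => /orP[|/eqP//]; rewrite lt_eqF// conormal_lt0//; case: bq.
have vT : boundary_tangent (grad u p) by rewrite /boundary_tangent gradientE// v0.
split => //; rewrite second_formE// [in RHS]mulNr opprK mulmx_normal//; congr (_ * _).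
rewrite -mulmxA [LHS]mxE; apply: eq_bigr => i _.
have [->|i0] := eqVneq i ord0; first by rewrite vT !mul0r.
congr (_ * _).
have : partial c i (fun q => (dform c u q *m G q) 0 ord0) p = 0.
  rewrite -[RHS](partial_cst 0 i Dp); exact: partial_eq_boundary.
rewrite partial_entry mpartM//; last exact: ginv_diff.
rewrite ginv_compat// mulmxBr mulmxN !mulmxA -gradientE// addrA -mulmxBl.
have -> : mpart c i (dform c u) p - dform c u p *m chr g c i p = row i (hess u p).
  by rewrite hessian_row.
rewrite mxaddE mxoppE => /subr0_eq; rewrite -row_mul [row _ _ _ _]mxE => ->.
by rewrite -[in RHS](trmxK (chr g c i p)) -trmx_mul [RHS]mxE.
Qed.

(* The inverse of the tangential block of the metric is the Schur complement of
   the entry [(0, 0)] of the inverse metric. *)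
Lemma metric_tangent_inv p : D p ->
  let P := G p - (G p ord0 ord0)^-1 *: (col ord0 (G p) *m row ord0 (G p)) in
  (forall i, P i ord0 = 0 /\ P ord0 i = 0) /\
  invmx (\matrix_(a < n, b < n) inner g c p (boundary_basis R a) (boundary_basis R b)) =
  \matrix_(a < n, b < n) P (lift ord0 a) (lift ord0 b).
Proof.
move=> Dp P; have G0 : G p ord0 ord0 != 0 by rewrite gt_eqF// ginv00_gt0.
have PE i j : P i j = G p i j - (G p ord0 ord0)^-1 * (G p i ord0 * G p ord0 j).
  rewrite mxaddE mxoppE mxscaleE; congr (_ - _ * _).
  by rewrite [LHS]mxE big_ord1 [col _ _ _ _]mxE [row _ _ _ _]mxE.
have P0 i : P i ord0 = 0 /\ P ord0 i = 0.
  by rewrite !PE; split; [rewrite (mulrC (G p i ord0)) | ]; rewrite mulKf// subrr.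
split => //.
set K := (X in invmx X); set K' := (X in _ = X).
have KK : K' *m K = 1%:M.
  apply/matrixP => a b; rewrite [LHS]mxE.
  transitivity ((P *m gc p) (lift ord0 a) (lift ord0 b)).
    rewrite [RHS]mxE big_ord_recl (P0 _).1 mul0r add0r; apply: eq_bigr => d _.
    rewrite [K' _ _]mxE [K _ _]mxE /inner mulmx_basis /boundary_basis /basis_vec.
    by rewrite -rowE [row _ _ _ _]mxE.
  rewrite mulmxBl ginv_mulmx// -scalemxAl -mulmxA -row_mul ginv_mulmx// mxaddE mxoppE mxscaleE.
  rewrite [(_ *m row _ _) _ _]mxE big_ord1 [row _ _ _ _]mxE ![1%:M _ _]mxE.
  by rewrite /= !mulr0 subr0.
have [_ uK] := mulmx1_unit KK.
by rewrite -[RHS]mulmx1 -(mulmxV uK) mulmxA KK mul1mx.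
Qed.

(** Here [dform c u p 0 ord0 / conormal p] is u_nu, and the left-hand side is u_nu D^2 u (nu, nu).
    At p the equation gives Delta u = h_nu u_nu, while the trace of D^2 u over the tangent space of
    the boundary is H u_nu; the difference is D^2 u (nu, nu). *)
Lemma dirichlet_energy u h lam p : chart_diff c 3 u -> bnd p ->
  (forall q, D q -> - drift_laplacian g h u c q = lam * u q) ->
  (forall q, bnd q -> u q = 0) ->
  ((grad u p *m hess u p) *m (nu c p)^T) 0 0 =
  - (dform c u p 0 ord0 / conormal p) ^+ 2 * (mean_curvature g nu c p - normal_deriv g nu h c p).
Proof.
move=> du bp Hu u0; have Dp := bp.1.
have du2 := chart_diff_pred du; have du1 := chart_diff_pred du2.
have pa a q : a != ord0 -> bnd q -> partial c a u q = 0.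
  by move=> a0 bq; rewrite -[RHS](partial_cst 0 a bq.1); apply: partial_eq_boundary.
have pab a b : a != ord0 -> b != ord0 -> partial c a (partial c b u) p = 0.
  move=> a0 b0; rewrite -[RHS](partial_cst 0 a Dp).
  by apply: partial_eq_boundary => // q bq; exact: pa.
set w0 := dform c u p 0 ord0.
have wE : dform c u p = w0 *: delta_mx 0 ord0.
  apply/rowP => j; rewrite mxscaleE [delta_mx _ _ _ _]mxE eqxx /=.
  have [->|j0] := eqVneq j ord0; first by rewrite mulr1.
  by rewrite mulr0 [LHS]mxE pa.
have vE : grad u p = w0 *: row ord0 (G p) by rewrite gradientE// wE -scalemxAl -rowE.
set s := conormal p; have s0 : s != 0 by rewrite lt_eqF// conormal_lt0.
have s2 : s ^+ 2 = (G p ord0 ord0)^-1.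
  have := conormal_sqr Dp; rewrite -/s => /(canRL (mulfK _)) ->; first by rewrite mul1r.
  by rewrite gt_eqF// ginv00_gt0.
set H := hess u p; set mc := mean_curvature _ _ _ _.
pose P := G p - (G p ord0 ord0)^-1 *: (col ord0 (G p) *m row ord0 (G p)).
have [P0 KE] := metric_tangent_inv Dp.
(* As u vanishes on the boundary, a tangential entry of its Hessian reduces to the Christoffel term
   in the derivative along e_0, which is the second fundamental form by [second_formE]. *)
have IIE a b : w0 * second_form g nu c p (boundary_basis R a) (boundary_basis R b) =
    s * H (lift ord0 a) (lift ord0 b).
  have tb d : boundary_tangent (boundary_basis R d).
    by rewrite /boundary_tangent mxE andbF.
  rewrite second_formE// (bigD1 (lift ord0 a))//= big1 ?addr0; last first.
    by move=> i ia; rewrite [basis_vec _ _ _ _]mxE (negbTE ia) andbF mul0r.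
  rewrite [basis_vec _ _ _ _]mxE !eqxx mul1r mulmx_basis [chr _ _ _ _ _ _]mxE.
  rewrite /H hessianE pab// sub0r big_ord_recl big1 ?addr0; last first.
    by move=> k _; rewrite pa// mulr0.
  have -> : partial c ord0 u p = w0 by rewrite /w0 [RHS]mxE.
  rewrite -/s; ring.
have mcE : w0 * mc = s * \tr (P *m H).
  rewrite /mc /mean_curvature KE /mxtrace !mulr_sumr.
  have PH0 : (P *m H) ord0 ord0 = 0.
    by rewrite mxE big1// => j _; rewrite (P0 j).2 mul0r.
  rewrite [RHS]big_ord_recl PH0 mulr0 add0r.
  apply: eq_bigr => a _; rewrite [in LHS]mxE [in RHS]mxE [in RHS]big_ord_recl.
  rewrite (P0 _).1 mul0r add0r !mulr_sumr; apply: eq_bigr => b _.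
  by rewrite [X in w0 * (X * _)]mxE [X in w0 * (_ * X)]mxE [LHS]mulrCA IIE [LHS]mulrCA.
(* P is the inverse metric minus the square of [nu], so D^2 u (nu, nu) splits off from the
   Laplacian. *)
have trP : \tr (P *m H) = \tr (G p *m H) - s ^+ 2 * (row ord0 (G p) *m H *m col ord0 (G p)) 0 0.
  have tr1 : \tr (col ord0 (G p) *m row ord0 (G p) *m H) =
      (row ord0 (G p) *m H *m col ord0 (G p)) 0 0.
    by rewrite -mulmxA mxtrace_mulC /mxtrace big_ord1.
  by rewrite mulmxBl raddfB /= -scalemxAl mxtraceZ -s2 tr1.
have lapE : \tr (G p *m H) = w0 * grad h p 0 ord0.
  rewrite -[LHS]/(laplacian g u c p) (laplacian_eigen Hu Dp) u0// mulr0 subr0.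
  rewrite wE [(_ *: _)^T]linearZ /= -scalemxAr mxscaleE trmx_delta -colE [col _ _ _ _]mxE.
  by rewrite -gradientE.
rewrite normal_derivE// -/s mulmx_normal// -/s vE -!scalemxAl mxscaleE.
have -> : (row ord0 (G p) *m H *m G p) 0 ord0 = (row ord0 (G p) *m H *m col ord0 (G p)) 0 0.
  by rewrite colE mulmxA -colE [RHS]mxE.
have aux (y z t a m : R) : a * m = s * t -> t = a * y - s ^+ 2 * z ->
    s * (a * z) = - (a / s) ^+ 2 * (m - s * y).
  move=> E tE; have -> : - (a / s) ^+ 2 * (m - s * y) =
    a ^+ 2 * y / s - a / s ^+ 2 * (a * m) by field.
  by rewrite E tE; field.
by apply: aux mcE _; rewrite trP lapE.
Qed.
End Boundary.

(** * From charts to the manifold *)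

Section Critical.
Variables (R : realType) (n : nat) (M : bmanifold R n).
Implicit Types (c : charts M) (p q : M) (f u h : M -> R).
Local Notation V := 'rV[R]_n.+1.

Lemma dform_basis c f p i : (dform c f p *m (basis_vec R i)^T) 0 0 = partial c i f p.
Proof. by rewrite mulmx_basis mxE. Qed.

Lemma max_partial0 c f p i : chart_diff c 1 f -> cdom c p ->
  (forall q, cdom c q -> f q <= f p) ->
  0 < cmap c p 0 ord0 \/ i != ord0 -> partial c i f p = 0.
Proof.
move=> df Dp fmax Hi; apply/eqP; rewrite eq_le; apply/andP; split.
  rewrite -dform_basis; apply: max_direction => //; right; exact: basis_vec_ge0.
rewrite -oppr_le0 -dform_basis -mxoppE -mulmxN -trmxN; apply: max_direction => //.
case: Hi => [|i0]; [by left|right].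
by rewrite mxoppE [basis_vec _ _ _ _]mxE (eq_sym ord0) (negbTE i0) andbF oppr0.
Qed.

(** At a boundary point the tangential directions are admissible with both signs, so the normal
    derivative is [partial c ord0 f p] times the negative component of [nu]. Its sign bounds that
    partial derivative from below, the inward ray from above. *)
Lemma max_critical (g : riem_metric M) (nu : charts M -> M -> V) c f p :
  outward_unit_normal g nu -> chart_diff c 1 f -> cdom c p ->
  (forall q, cdom c q -> f q <= f p) ->
  (boundary_pt c p -> (dform c f p *m (nu c p)^T) 0 0 <= 0) -> dform c f p = 0.
Proof.
move=> nuP df Dp fmax fnu; apply/rowP => i; rewrite [LHS]mxE [RHS]mxE.
have := cmap_ge0 Dp; rewrite le_eqVlt => /orP[/eqP p0|p0]; last first.
  by apply: max_partial0 => //; left.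
have bp : boundary_pt c p by split.
have tang j : j != ord0 -> partial c j f p = 0.
  by move=> j0; apply: max_partial0 => //; right.
have [->|i0] := eqVneq i ord0; last exact: tang.
apply/eqP; rewrite eq_le; apply/andP; split.
  rewrite -dform_basis; apply: max_direction => //; right; exact: basis_vec_ge0.
have [_ _ nu0] := nuP c p bp.
have := fnu bp; rewrite mxE big_ord_recl big1 ?addr0 => [|j _]; last first.
  by rewrite [dform _ _ _ _ _]mxE tang ?mul0r.
by rewrite [dform _ _ _ _ _]mxE [_^T _ _]mxE nmulr_lle0.
Qed.

Lemma cmap_continuous_at c p : cdom c p -> {for p, continuous (cmap c)}.
Proof.
move=> Dp; have := @cmap_continuous _ _ _ c.
by rewrite continuous_open_subspace; [apply; rewrite inE|exact: cdom_open].
Qed.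

Lemma near_chart c p (Z : set V) : cdom c p -> open Z -> Z (cmap c p) ->
  \forall q \near p, cdom c q /\ Z (cmap c q).
Proof.
move=> Dp oZ Zp; apply: filterI.
  by apply: open_nbhs_nbhs; split => //; exact: cdom_open.
by apply: cmap_continuous_at => //; apply: open_nbhs_nbhs.
Qed.

Lemma chart_diff_continuous c f p : chart_diff c 1 f -> cdom c p -> {for p, continuous f}.
Proof.
move=> df Dp; have [Z [F [oZ Zp [dF _] FE]]] := df p Dp.
have cF := differentiable_continuous (dF _ Zp).
have cFp : F (cmap c q) @[q --> p] --> F (cmap c p).
  by apply: continuous_comp => //; exact: cmap_continuous_at.
rewrite /prop_for /continuous_at -(FE p)//; apply: cvg_trans cFp.
apply: near_eq_cvg; apply: filterS (near_chart Dp oZ Zp) => q [Dq Zq].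
by rewrite FE.
Qed.

(** A ball intersected with the half-space is convex, so the segment between two nearby chart images
    stays in the chart and the mean value theorem applies. *)
Lemma dform0_locally_constant c f p : chart_diff c 1 f ->
  (forall q, cdom c q -> dform c f q = 0) -> cdom c p -> \forall q \near p, f q = f p.
Proof.
move=> df f0 Dp; have [Z [F [oZ Zp [dF _] FE]]] := df p Dp.
have [Z' oZ' E] := @cimg_open _ _ _ c.
have imgP q : cdom c q -> Z' (cmap c q).
  move=> Dq; have : (cmap c @` cdom c) (cmap c q) by exists q.
  by rewrite E => -[].
have /nbhs_ballP[e /= e0 He] : nbhs (cmap c p) (Z `&` Z').
  by apply: open_nbhs_nbhs; split; [exact: openI|split => //; exact: imgP].
have oB : open (ball (cmap c p) e) by exact: ball_open.
have Bp : ball (cmap c p) e (cmap c p) by exact: ballxx.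
have := near_chart Dp oB Bp.
apply: filterS => q [Dq Bq].
pose v := cmap c q - cmap c p.
have seg s : 0 <= s <= 1 -> ball (cmap c p) e (cmap c p + s *: v).
  move=> /andP[s0 s1]; rewrite -ball_normE /ball_ /=.
  rewrite opprD addrA subrr add0r normrN normrZ ger0_norm//.
  move: Bq; rewrite -ball_normE /ball_ /= distrC -/v; apply: le_lt_trans.
  by rewrite -[leRHS]mul1r ler_wpM2r.
have [s /andP[s0 s1] Es] : exists2 s, 0 < s < 1 &
    F (cmap c p + 1 *: v) - F (cmap c p) = 1 * 'D_v F (cmap c p + s *: v).
  by apply: mvt_line => // s hs; apply: dF; have [] := He _ (seg s hs).
have hs : 0 <= s <= 1 by rewrite !ltW.
have [Zs Z's] := He _ (seg s hs).
have imgs : (cmap c @` cdom c) (cmap c p + s *: v).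
  rewrite E; split => //; rewrite /half_space /=.
  have -> : (cmap c p + s *: v) 0 ord0 = (1 - s) * cmap c p 0 ord0 + s * cmap c q 0 ord0.
    by rewrite /v mxaddE mxscaleE mxaddE mxoppE; ring.
  by rewrite addr_ge0// mulr_ge0// ?subr_ge0 ?cmap_ge0 ?ltW.
have [Ds sE] := cinv_img imgs.
have qE : cmap c p + v = cmap c q by rewrite /v addrC subrK.
move: Es; rewrite scale1r qE (FE q Dq (He _ Bq).1) (FE p Dp Zp).
rewrite mul1r (derive_coord _ (dF _ Zs)) big1 => [/subr0_eq//|i _].
have Zs' : Z (cmap c (cinv c (cmap c p + s *: v))) by rewrite sE.
rewrite -sE -(partialE i Ds oZ Zs' (dF _ Zs') FE).
by have /rowP/(_ i) := f0 _ Ds; rewrite [X in X = _]mxE [X in _ = X]mxE => ->; rewrite mulr0.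
Qed.

(** Level sets of f are open and closed, hence contain every component that they meet. *)
Lemma locally_constant_component f p q : (forall x, \forall y \near x, f y = f x) ->
  connected_component [set: M] p q -> f q = f p.
Proof.
move=> lc Cq.
have fopen (a : R) : open [set x | f x = a].
  by rewrite openE => x /= <-; exact: lc.
have cC : connected (connected_component [set: M] p) by exact: component_connected.
set C := connected_component _ _ in Cq cC.
have : C `&` [set x | f x = f p] = C.
  apply: cC.
  - by exists p; split => //; exact: connected_component_refl.
  - by exists [set x | f x = f p].
  - exists [set x | f x = f p] => //; rewrite -openC openE => x /= fx.
    by apply: filterS (lc x) => y fy; rewrite /= fy.
by move=> CE; move: Cq; rewrite -CE => -[].
Qed.

(** Each coordinate of the transition map comes with its own local extension. These are assembled
    into one map [Phi], and [U \o Phi] extends f in the chart c when U extends it in c'. *)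
Lemma chain_rule c c' f p : chart_diff c' 1 f -> cdom c p -> cdom c' p ->
  dform c f p = dform c' f p *m Defs.jacobian c c' p.
Proof.
move=> df Dp Dp'; set x := cmap c p; set x' := cmap c' p.
have [Z [U [oZ Zp [dU _] UE]]] := df p Dp'.
have img : (cmap c @` (cdom c `&` cdom c')) x by exists p.
have /choice[ZF HF] : forall i, exists ZF : set V * (V -> R), [/\ open ZF.1, ZF.1 x,
    smooth_open ZF.1 ZF.2 & forall y, ZF.1 y -> (cmap c @` (cdom c `&` cdom c')) y ->
      ZF.2 y = cmap c' (cinv c y) 0 i].
  move=> i; have [W [F [oW Wx sF FE]]] := charts_compatible i img.
  by exists (W, F).
pose F i := (ZF i).2.
have dF i : differentiable (F i) x by have [_ Wx sF _] := HF i; exact: (sF [::]).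
pose Phi y := \sum_i F i y *: basis_vec R i.
have dterm i : differentiable (fun y => F i y *: basis_vec R i) x.
  by apply: differentiableZl.
have PhiE : Phi = \sum_i (fun y => F i y *: basis_vec R i).
  by apply/funext => y; rewrite fct_sumE.
have dPhi : differentiable Phi x by rewrite PhiE; exact: differentiable_sum.
have PhiM q : cdom c q -> cdom c' q -> (forall i, (ZF i).1 (cmap c q)) ->
    Phi (cmap c q) = cmap c' q.
  move=> Dq Dq' Wq; rewrite /Phi [RHS]row_sum_delta; apply: eq_bigr => i _.
  congr (_ *: _); rewrite /F; have [_ _ _ ->//] := HF i; first by rewrite cmapK.
  by exists q.
have Wp i : (ZF i).1 x by have [] := HF i.
have nearW : \forall y \near x, forall i, (ZF i).1 y.
  apply: (@filter_forall _ _ (fun i => (ZF i).1) (nbhs x) _) => i.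
  apply: open_nbhs_nbhs; split => //.
  by have [] := HF i.
(* Only points of the chart image matter here, and on it [cinv c] is continuous. *)
have nearD : \forall y \near x, (cmap c @` cdom c) y -> cdom c' (cinv c y).
  have /subspace_continuousP := @cinv_continuous _ _ _ c.
  move=> /(_ x) H; have Sx : (cmap c @` cdom c) x by exists p.
  suff H' : nbhs (cinv c x) (cdom c') by exact: (H Sx _ H').
  by rewrite /x cmapK//; apply: open_nbhs_nbhs; split => //; exact: cdom_open.
have nearZ : \forall y \near x, Z (Phi y).
  apply: (differentiable_continuous dPhi); apply: open_nbhs_nbhs; split => //.
  by rewrite PhiM.
have : \forall y \near x, [/\ forall i, (ZF i).1 y,
    (cmap c @` cdom c) y -> cdom c' (cinv c y) & Z (Phi y)].
  by near do split.
rewrite /prop_near1 nbhsE => -[W [oW Wx] HW].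
have dUx : differentiable U (Phi x) by rewrite PhiM//; exact: dU.
apply/rowP => j; rewrite [LHS]mxE.
rewrite (@partialE _ _ _ c W (U \o Phi) f p j Dp oW Wx); last 2 first.
- exact: differentiable_comp.
- move=> q Dq Wq; have [Wi D' Zq] := HW _ Wq.
  have Dq' : cdom c' q by rewrite -(cmapK Dq); apply: D'; exists q.
  by rewrite /= PhiM// UE// -PhiM.
rewrite (deriveE _ (differentiable_comp dPhi dUx)) diff_comp//= -(deriveE _ dPhi).
rewrite -(deriveE _ dUx) derive_coord// PhiM// [RHS]mxE; apply: eq_bigr => i _.
rewrite mulrC [dform _ _ _ _ _]mxE (partialE i Dp' oZ Zp (dU _ Zp) UE); congr (_ * _).
rewrite [RHS]mxE (@partialE _ _ _ c W (F i) _ p j Dp oW Wx (dF i)); last first.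
  move=> q Dq Wq; have [Wi D' Zq] := HW _ Wq.
  have Dq' : cdom c' q by rewrite -(cmapK Dq); apply: D'; exists q.
  by rewrite /F; have [_ _ _ ->//] := HF i; [rewrite cmapK|exists q].
rewrite PhiE derive_sum => [|k]; last exact: diff_derivable.
rewrite summxE (bigD1 i)//= big1 ?addr0 => [|k ki].
  rewrite (deriveE _ (dterm i)) diffZl// mxscaleE [basis_vec _ _ _ _]mxE !eqxx mulr1.
  by rewrite (deriveE _ (dF i)).
rewrite (deriveE _ (dterm k)) diffZl// mxscaleE [basis_vec _ _ _ _]mxE.
by rewrite (eq_sym i) (negbTE ki) andbF mulr0.
Unshelve. all: by end_near. Qed.

(** The transformation law of the metric, inverted, expresses the inverse metric in c' through J and
    the one in c. This makes the barrier a function on M, to which compactness applies. *)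
Lemma inner_gradient_change (g : riem_metric M) c c' f p :
  chart_diff c' 1 f -> cdom c p -> cdom c' p ->
  inner g c p (gradient g f c p) (gradient g f c p) =
  inner g c' p (gradient g f c' p) (gradient g f c' p).
Proof.
move=> df Dp Dp'; rewrite !inner_gradient// (chain_rule df Dp Dp').
set w := dform c' f p; set J := Defs.jacobian c c' p.
have gE : g c p = J^T *m g c' p *m J := gmat_change g Dp Dp'.
have uJ : J \in unitmx.
  by have := metric_unit g Dp; rewrite gE unitmx_mul => /andP[].
suff <- : J *m ginv g c p *m J^T = ginv g c' p by rewrite trmx_mul !mulmxA.
have E : J *m ginv g c p *m J^T *m g c' p = 1%:M.
  apply: (can_inj (mulmxK uJ)); rewrite mul1mx -[RHS]mulmx1 -(ginv_mulmx g Dp) gE.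
  by rewrite !mulmxA.
by rewrite -[LHS]mulmx1 -(mulmx_ginv g Dp') mulmxA E mul1mx.
Qed.
End Critical.

(** * The eigenvalue estimates *)

(** For lam > 0 the two coefficients require lam - A < b < lam / N, an interval that is nonempty
    exactly when lam < N A / (N - 1): this is the origin of the constant. For lam < 0 any b > 0
    serves. *)
Lemma barrier_weight_exists (R : realType) (N A lam : R) :
  1 < N -> 0 < A -> lam != 0 -> lam < N * A / (N - 1) ->
  exists b : R, [/\ 0 < b, 0 < lam ^+ 2 / N - b * lam & 0 < A - lam + b].
Proof.
move=> N1 A0 lam0 H; have N0 : 0 < N by apply: lt_trans N1.
have N10 : 0 < N - 1 by rewrite subr_gt0.
move: H; rewrite ltr_pdivlMr// => H.
have [lneg|lpos|/eqP] := ltgtP lam 0; last by rewrite (negbTE lam0).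
  exists 1; split => //; last lra.
  have : 0 <= lam ^+ 2 / N by rewrite divr_ge0 ?sqr_ge0// ltW.
  lra.
have lN : 0 < lam / N by rewrite divr_gt0.
have lA : lam - A < lam / N.
  by rewrite ltr_pdivlMr//; lra.
(* The maximum with 0 keeps b positive when lam < A. *)
pose m := Num.max 0 (lam - A).
have m1 : m < lam / N by rewrite gt_max lN lA.
have m2 : 0 <= m by rewrite le_max lexx.
have m3 : lam - A <= m by rewrite le_max lexx orbT.
exists ((m + lam / N) / 2); split; [lra| |lra].
have -> : lam ^+ 2 / N - (m + lam / N) / 2 * lam = lam * ((lam / N - m) / 2).
  by field; rewrite gt_eqF.
by rewrite mulr_gt0// divr_gt0// subr_gt0.
Qed.

Lemma pos_comb_le0 (R : realFieldType) (k l x y : R) : 0 < k -> 0 < l ->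
  0 <= x -> 0 <= y -> k * x + l * y <= 0 -> x = 0 /\ y = 0.
Proof.
move=> k0 l0 x0 y0 H.
have kx : 0 <= k * x by rewrite mulr_ge0// ltW.
have ly : 0 <= l * y by rewrite mulr_ge0// ltW.
have : (k * x == 0) && (l * y == 0) by rewrite -paddr_eq0// eq_le H addr_ge0.
by rewrite !mulf_eq0 (gt_eqF k0) (gt_eqF l0) /= => /andP[/eqP -> /eqP ->].
Qed.

(** All that the maximum principle needs to know about the boundary; the Dirichlet and Neumann cases
    share everything beyond it. *)
Definition barrier_normal_le0 (R : realType) (n : nat) (M : bmanifold R n)
    (g : riem_metric M) (nu : charts M -> M -> 'rV[R]_n.+1) (u : M -> R) (b : R) : Prop :=
  forall (c : charts M) (p : M), boundary_pt c p ->
    (dform c (barrier g c u b) p *m (nu c p)^T) 0 0 <= 0.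

Section Eigenvalues.
Variables (R : realType) (n : nat) (M : bmanifold R n) (g : riem_metric M).
Variables (nu : charts M -> M -> 'rV[R]_n.+1) (h u : M -> R) (A z lam : R).
Hypothesis Mcompact : compact [set: M].
Hypothesis nuP : outward_unit_normal g nu.
Hypothesis hsmooth : smooth h.
Hypothesis A0 : 0 < A.
Hypothesis z0 : 0 < z.
Hypothesis Hpsd : forall (c : charts M) (p : M), cdom c p ->
    psd (ricci g c p + hessian g h c p
         - (inner g c p (gradient g h c p) (gradient g h c p) / (n.+1%:R * z)
            + A) *: g c p).
Hypothesis usmooth : smooth u.
Hypothesis eigen : forall (c : charts M) (p : M), cdom c p ->
  - drift_laplacian g h u c p = lam * u p.
Implicit Types (c : charts M) (p q : M) (b : R).

Let Q c p : R := inner g c p (gradient g u c p) (gradient g u c p).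

Let Q_ge0 c p : cdom c p -> 0 <= Q c p.
Proof.
move=> Dp; have [E|v0] := eqVneq (gradient g u c p) 0.
  by rewrite /Q /inner E !mul0mx mxE.
exact/ltW/gmat_pos.
Qed.

Let gradient0 c p : cdom c p -> Q c p = 0 -> dform c u p = 0.
Proof.
move=> Dp Q0; have [E|v0] := eqVneq (gradient g u c p) 0; last first.
  by have := gmat_pos g Dp v0; rewrite -/(inner g c p _ _) -/(Q c p) Q0 ltxx.
move: E; rewrite gradientE// => /(congr1 (mulmx^~ (g c p))).
by rewrite mul0mx -mulmxA ginv_mulmx// mulmx1.
Qed.

Let barrierE c b p : barrier g c u b p = 2^-1 * Q c p + b / 2 * u p ^+ 2.
Proof. by rewrite expr2. Qed.

Let udiff c k : chart_diff c k u.
Proof. exact: smooth_chart_diff. Qed.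

Let barrier_change c c' b p : cdom c p -> cdom c' p -> barrier g c u b p = barrier g c' u b p.
Proof. by move=> Dp Dp'; rewrite !barrierE /Q (inner_gradient_change g (@udiff c' 1) Dp Dp'). Qed.

Lemma barrier_max b : (exists p : M, True) -> barrier_normal_le0 g nu u b ->
  exists c p, [/\ cdom c p,
    forall c' q, cdom c' q -> barrier g c' u b q <= barrier g c u b p &
    (lam ^+ 2 / (n.+1%:R * (z + 1)) - b * lam) * u p ^+ 2
      + (A - lam + b) * inner g c p (gradient g u c p) (gradient g u c p) <= 0].
Proof.
move=> [p1 _] Hb.
(* Choosing a chart at each point turns the barrier into a function on M; by chart independence a
   fixed chart computes it near a given point, whence continuity. *)
pose ch p := projT1 (cid (charts_cover p)).
have chP p : cdom (ch p) p by rewrite /ch; case: cid.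
pose F p := barrier g (ch p) u b p.
have FE c p : cdom c p -> F p = barrier g c u b p.
  by move=> Dp; exact: barrier_change.
have dB c k : chart_diff c k (barrier g c u b) by apply: barrier_diff; exact: udiff.
have Fc : continuous F.
  move=> p; have Bc := chart_diff_continuous (@dB (ch p) 1) (chP p).
  rewrite /continuous_at (FE _ _ (chP p)); apply: cvg_trans Bc; apply: near_eq_cvg.
  have : \forall q \near p, cdom (ch p) q.
    by apply: open_nbhs_nbhs; split; [exact: cdom_open|exact: chP].
  by apply: filterS => q Dq; rewrite (FE _ _ Dq).
have S0 : [set: M] !=set0 by exists p1.
have [p0 _ Hmax] := compact_EVT_max S0 Mcompact (continuous_subspaceT Fc).
have Dp := chP p0.
have Fmax c' q : cdom c' q -> barrier g c' u b q <= barrier g (ch p0) u b p0.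
  by move=> Dq; rewrite -(FE c')//; apply: Hmax; rewrite inE.
exists (ch p0), p0; split => //.
have Bmax q : cdom (ch p0) q -> barrier g (ch p0) u b q <= barrier g (ch p0) u b p0.
  exact: Fmax.
have crit : dform (ch p0) (barrier g (ch p0) u b) p0 = 0.
  apply: (max_critical nuP) => //; exact: Hb.
have hdiff k : chart_diff (ch p0) k h by exact: smooth_chart_diff.
apply: le_trans (drift_laplacian_max g h (@dB (ch p0) 2) Dp Bmax crit).
by apply: drift_barrier_ge => //; [exact: eigen|exact: Hpsd].
Qed.

Lemma nonzero_eigenvalue_ge : lam != 0 -> (exists p, u p <> 0) ->
  (forall b, barrier_normal_le0 g nu u b) ->
  n.+1%:R * (z + 1) * A / (n.+1%:R * (z + 1) - 1) <= lam.
Proof.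
move=> lam0 [p1 up1] Hb; rewrite leNgt; apply/negP => Hlt.
have N1 : 1 < n.+1%:R * (z + 1) :> R.
  by rewrite mulrDr mulr1 ltr_pwDl ?mulr_gt0 ?ltr0n// ler1n.
have [b [b0 K1 K2]] := barrier_weight_exists N1 A0 lam0 Hlt.
have [c [p [Dp Fmax Hle]]] := barrier_max (ex_intro _ p1 I) (Hb b).
have Qp := Q_ge0 Dp; have u2 := sqr_ge0 (u p).
have [U0 Q0] := pos_comb_le0 K1 K2 u2 Qp Hle.
have [c1 Dp1] := charts_cover p1.
have := Fmax c1 p1 Dp1; rewrite !barrierE Q0 U0 !mulr0 addr0.
rewrite addrC => /(pos_comb_le0 _ _ (sqr_ge0 _) (Q_ge0 Dp1))[]; rewrite ?divr_gt0//.
by move/eqP; rewrite sqrf_eq0 => /eqP.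
Qed.

Lemma zero_eigenvalue_locally_constant : lam = 0 -> barrier_normal_le0 g nu u 0 ->
  forall p, \forall q \near p, u q = u p.
Proof.
move=> lam0 Hb p; have [c [p0 [Dp0 Fmax Hle]]] := barrier_max (ex_intro _ p I) Hb.
have Qp0 := Q_ge0 Dp0.
(* With lam = b = 0 the inequality at the maximum reads A |Du|^2 <= 0. *)
have Q0 : Q c p0 = 0.
  move: Hle; rewrite lam0 expr0n /= !mul0r subrr mul0r add0r subr0 addr0 pmulr_rle0// => Hle.
  by apply/eqP; rewrite eq_le Hle.
have du0 c' q : cdom c' q -> dform c' u q = 0.
  move=> Dq; apply: gradient0 => //; apply/eqP; rewrite eq_le Q_ge0// andbT.
  have := Fmax c' q Dq; rewrite !barrierE Q0 !mul0r mulr0 !addr0.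
  by rewrite pmulr_rle0// invr_gt0.
have [c' Dp] := charts_cover p.
exact: (dform0_locally_constant (@udiff c' 1) (du0 c') Dp).
Qed.

Lemma dform_barrier c b p : cdom c p -> dform c (barrier g c u b) p =
  gradient g u c p *m hessian g u c p + (b * u p) *: dform c u p.
Proof.
move=> Dp; have dU := @udiff c 1.
rewrite /barrier dformD//; last 2 first.
- by apply: energy_diff; exact: udiff.
- by apply: chart_diffM; [exact: chart_diff_cst|exact: chart_diffM].
rewrite (dform_energy g (@udiff c 4) Dp); congr (_ + _).
rewrite dformM//; [|exact: chart_diff_cst|exact: chart_diffM].
have -> : dform c (fun=> b / 2) p = 0.
  by apply/rowP => i; rewrite [LHS]mxE partial_cst// [RHS]mxE.
rewrite scaler0 add0r dformM// -scalerDl scalerA; congr (_ *: _).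
by field.
Qed.

Lemma neumann_barrier b : convex_boundary g nu ->
  (forall c p, boundary_pt c p -> normal_deriv g nu u c p = 0) -> barrier_normal_le0 g nu u b.
Proof.
move=> cvx un c p bp; have Dp := bp.1.
rewrite dform_barrier// mulmxDl mxaddE -scalemxAl mxscaleE.
have -> : (dform c u p *m (nu c p)^T) 0 0 = 0.
  by rewrite (mulmx_normal nuP)// -gradientE// -(normal_derivE nuP) ?un.
have [vT ->] := neumann_energy nuP (@udiff c 3) bp (un c).
by rewrite mulr0 addr0 oppr_le0; exact: cvx.
Qed.

Lemma dirichlet_barrier b :
  (forall (c : charts M) (p : M), boundary_pt c p ->
     0 <= mean_curvature g nu c p - normal_deriv g nu h c p) ->
  (forall p, boundary M p -> u p = 0) -> barrier_normal_le0 g nu u b.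
Proof.
move=> mc u0 c p bp; have Dp := bp.1.
have u0c q : boundary_pt c q -> u q = 0 by move=> bq; apply: u0; exists c.
rewrite dform_barrier// u0c// mulr0 scale0r addr0.
rewrite (dirichlet_energy nuP (@udiff c 3) bp (eigen (c := c)) u0c).
by rewrite mulNr oppr_le0 mulr_ge0 ?sqr_ge0// mc.
Qed.
End Eigenvalues.

Theorem theorem2 (R : realType) (n : nat) (M : bmanifold R n) (g : riem_metric M)
    (nu : charts M -> M -> 'rV[R]_n.+1) (h : M -> R) (A z : R) :
  compact [set: M] ->
  outward_unit_normal g nu ->
  smooth h ->
  0 < A -> 0 < z ->
  (forall (c : charts M) (p : M), cdom c p ->
    psd (ricci g c p + hessian g h c p
         - (inner g c p (gradient g h c p) (gradient g h c p) / (n.+1%:R * z)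
            + A) *: g c p)) ->
  ((forall p : M, connected_component [set: M] p `&` boundary M !=set0) ->
   (forall (c : charts M) (p : M), boundary_pt c p ->
     0 <= mean_curvature g nu c p - normal_deriv g nu h c p) ->
   forall lambdaD : R, first_dirichlet_eigenvalue g h lambdaD ->
     n.+1%:R * (z + 1) * A / (n.+1%:R * (z + 1) - 1) <= lambdaD)
  /\
  (convex_boundary g nu ->
   forall lambdaN : R, first_neumann_eigenvalue g nu h lambdaN ->
     n.+1%:R * (z + 1) * A / (n.+1%:R * (z + 1) - 1) <= lambdaN).
Proof.
move=> Mc nuP hs A0 z0 Hpsd; split.
  move=> Hcomp mc lam [[u [us [p up] eig] u0] _].
  have bc b : barrier_normal_le0 g nu u b.
    exact: (dirichlet_barrier nuP us eig).
  (* For lam = 0 the coefficient of u^2 vanishes whatever b is, so this case rests on the boundary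
     point in the component of p. *)
  have [lam0|lam0] := eqVneq lam 0; last first.
    apply: (nonzero_eigenvalue_ge Mc nuP hs A0 z0 Hpsd us eig lam0 _ bc).
    by exists p.
  have lc := zero_eigenvalue_locally_constant Mc nuP hs A0 z0 Hpsd us eig lam0 (bc 0).
  have [q [Cq bq]] := Hcomp p.
  by case: up; rewrite -(locally_constant_component lc Cq) u0.
move=> cvx lam [[u [us ex eig] un] lam0 _].
apply: (nonzero_eigenvalue_ge Mc nuP hs A0 z0 Hpsd us eig lam0 ex) => b.
exact: neumann_barrier.
Qed.
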